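(* Let $P$ be the uniform distribution on the boundary of the regular hexagon with vertices $O(0,0)$, $A_1(1,0)$, $A_2(\frac32,\frac{\sqrt3}{2})$, $A_3(1,\sqrt3)$, $A_4(0,\sqrt3)$, $A_5(-\frac12,\frac{\sqrt3}{2})$. Let $n\in\mathbb{N}$ be such that $n=6k$ for some positive integer $k$. Put $$r=\frac{2\left(\sqrt{13}\,(k-1)-4\right)}{13(k-1)^2-16},$$ let $$\gamma=\begin{cases}\left\{\left(r+\frac{2j-1}{2(k-1)}(1-2r),\,0\right): j=1,2,\dots,k-1\right\} & \text{if } k\ge 2,\\ \emptyset & \text{if } k=1,\end{cases}$$ and let $T_1,\dots,T_5$ be affine transformations of $\mathbb{R}^2$ such that $T_i(OA_1)=A_iA_{i+1}$ for $1\le i\le 4$ and $T_5(OA_1)=A_5O$. Then the optimal set of $n$-means for $P$ is $$\alpha_n=\Big\{\big(\tfrac r8,\tfrac{\sqrt3 r}{8}\big),\big(1-\tfrac r8,\tfrac{\sqrt3 r}{8}\big),\big(\tfrac{6-r}{4},\tfrac{\sqrt3}{2}\big),\big(1-\tfrac r8,-\tfrac{\sqrt3}{8}(r-8)\big),\big(\tfrac r8,-\tfrac{\sqrt3}{8}(r-8)\big),\big(\tfrac{r-2}{4},\tfrac{\sqrt3}{2}\big)\Big\}\cup\gamma\cup\bigcup_{i=1}^5T_i(\gamma),$$ and the $n$th quantization error is $$V_n=\frac{13\left(13(k-1)^2-8\sqrt{13}\,(k-1)+16\right)}{12\left(16-13(k-1)^2\right)^2}.$$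
   Context: For a Borel probability measure $P$ on $\mathbb{R}^2$ with finite second moment, the $n$th quantization error is $V_n=V_n(P)=\inf\{\int\min_{a\in\alpha}\|x-a\|^2\,dP(x):\alpha\subset\mathbb{R}^2,\ \mathrm{card}(\alpha)\le n\}$, where $\|\cdot\|$ is the Euclidean norm. A set $\alpha$ with at most $n$ points attaining this infimum is called an optimal set of $n$-means for $P$. The uniform distribution on the hexagon boundary (total length $6$, side length $1$) is normalized arc length, i.e. $dP=\frac16\,ds$. For points $A,B$, $AB$ denotes the closed line segment joining them. *)

(* Defs.v *)
From HB Require Import structures.
From mathcomp Require Import all_boot all_order all_algebra.
From mathcomp Require Import all_classical all_reals all_analysis measurable_realfun.
From mathcomp Require Import ring lra.
Set Implicit Arguments.
Unset Strict Implicit.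
Unset Printing Implicit Defensive.
Import Order.TTheory GRing.Theory Num.Theory.
Import numFieldNormedType.Exports.
Local Open Scope card_scope.
Local Open Scope classical_set_scope.
Local Open Scope ring_scope.

(* R x R carries the product sigma-algebra, which is the Borel sigma-algebra
   of the plane. *)
Notation plane R := (R * R)%type.

(* The library norm on R * R is the sup norm, hence this definition. *)
Definition enorm (R : realType) (x : plane R) : R :=
  Num.sqrt (x.1 ^+ 2 + x.2 ^+ 2).

Lemma enorm_ge0 (R : realType) (x : plane R) : 0 <= enorm x.
Proof. exact: sqrtr_ge0. Qed.

Definition seg_param (R : realType) (A B : plane R) (t : R) : plane R :=
  ((1 - t) * A.1 + t * B.1, (1 - t) * A.2 + t * B.2).

Definition segment (R : realType) (A B : plane R) : set (plane R) :=
  [set seg_param A B t | t in `[0, 1]].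

Lemma measurable_seg_param (R : realType) (A B : plane R) :
  measurable_fun [set: R] (seg_param A B).
Proof.
apply: measurable_fun_pair; apply: measurable_funD;
  apply: measurable_funM => //; exact: measurable_funB.
Qed.

HB.instance Definition _ (R : realType) (A B : plane R) :=
  isMeasurableFun.Build _ _ _ _ (seg_param A B) (@measurable_seg_param R A B).

(* ds on AB: the affine parametrization over [0, 1] has constant speed
   |B - A|. *)
Definition arc_length (R : realType) (A B : plane R) :
    set (plane R) -> \bar R :=
  pushforward
    (mscale (NngNum (enorm_ge0 (B - A)))
       (mrestr (@lebesgue_measure R) (measurable_itv `[0, 1])))
    (seg_param A B).

HB.instance Definition _ (R : realType) (A B : plane R) :=
  Measure.copy (arc_length A B)
    (measure_function_pushforward__canonical__measure_function_Measure
      (mscale (NngNum (enorm_ge0 (B - A)))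
        (mrestr (@lebesgue_measure R) (measurable_itv `[0, 1])))
      (@measurable_seg_param R A B)).

(* The vertices O, A_1, ..., A_5 in cyclic order, with indices mod 6; in
   particular hexv R 6 = O. *)
Definition hexv (R : realType) (i : nat) : plane R :=
  nth (0, 0)
    [:: (0, 0); (1, 0); (3 / 2, Num.sqrt 3 / 2); (1, Num.sqrt 3);
        (0, Num.sqrt 3); (- (1 / 2), Num.sqrt 3 / 2)] (i %% 6).

Lemma sixthV_ge0 (R : realType) : 0 <= 6^-1 :> R.
Proof. by []. Qed.

(* dP = (1/6) ds on the boundary. *)
Definition hexagon_uniform (R : realType) : set (plane R) -> \bar R :=
  mscale (NngNum (sixthV_ge0 R))
    (msum (fun i => arc_length (hexv R i) (hexv R i.+1)) 6).
Arguments hexagon_uniform : clear implicits.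

HB.instance Definition _ (R : realType) :=
  Measure.on (hexagon_uniform R).

Lemma enorm_hexedge (R : realType) (i : nat) : (i < 6)%N ->
  enorm (hexv R i.+1 - hexv R i) = 1.
Proof.
have s3 : Num.sqrt 3 ^+ 2 = 3 :> R by rewrite sqr_sqrtr.
rewrite /enorm -[RHS]sqrtr1 => i6; congr Num.sqrt.
case: i i6 => [|[|[|[|[|[|//]]]]]] _; rewrite /hexv /=; nra.
Qed.

Lemma hexagon_uniform_setT (R : realType) :
  hexagon_uniform R [set: plane R] = 1%E.
Proof.
rewrite /hexagon_uniform /mscale /= /msum.
rewrite (eq_bigr (fun=> 1%E)) => [|[i i6] _ /=].
  by rewrite !big_ord_recl big_ord0 -!EFinD -EFinM; congr EFin; field.
rewrite /arc_length /mscale /= enorm_hexedge// /pushforward preimage_setT.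
by rewrite /mrestr setTI lebesgue_measure_itv/= lte01 oppr0 adde0 mule1.
Qed.

HB.instance Definition _ (R : realType) :=
  Measure_isProbability.Build _ _ _ (hexagon_uniform R)
    (hexagon_uniform_setT R).

(* The infimum is taken in \bar R: it is the minimum when alpha is finite and
   nonempty, and +oo when alpha is empty, so the empty set (which satisfies
   the cardinality bound) never influences quantization_error. *)
Definition distortion (R : realType) (P : probability (plane R) R)
    (alpha : set (plane R)) : \bar R :=
  (\int[P]_x ereal_inf [set (enorm (x - a) ^+ 2)%:E | a in alpha])%E.

Definition quantization_error (R : realType)
    (P : probability (plane R) R) (n : nat) : \bar R :=
  ereal_inf [set distortion P alpha | alpha in [set alpha | alpha #<= `I_n]].

Definition optimal_set (R : realType) (P : probability (plane R) R)
    (n : nat) (alpha : set (plane R)) : Prop :=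
  alpha #<= `I_n /\ distortion P alpha = quantization_error P n.

(* Affine transformations are invertible, hence the determinant condition. *)
Definition affine_transformation (R : realType) (T : plane R -> plane R)
    : Prop :=
  exists a b c d e f : R, a * d - b * c != 0 /\
    forall x : plane R,
      T x = (a * x.1 + b * x.2 + e, c * x.1 + d * x.2 + f).

(* Main.v *)
Require Import Defs.
From HB Require Import structures.
From mathcomp Require Import all_boot all_order all_algebra.
From mathcomp Require Import all_classical all_reals all_analysis.
From mathcomp Require Import measurable_realfun ring lra zify.
Set Implicit Arguments.
Unset Strict Implicit.
Unset Printing Implicit Defensive.
Import Order.TTheory GRing.Theory Num.Theory.
Import numFieldNormedType.Exports.
Local Open Scope card_scope.
Local Open Scope classical_set_scope.
Local Open Scope ring_scope.

(** The lower bound is a linear-programming duality. Let g be a price on the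
boundary, constant equal to 13 r^2 / 16 at distance at least r from the
vertices and decreasing linearly, at speed c r with c = 13 (4 - sqrt 13) / 48,
towards each vertex. Pointwise, min_a |x - a|^2 >= g - sum_a (g - |x - a|^2)^+.
The slope c is chosen so that no point a of the plane has a total gain
int (g - |x - a|^2)^+ above C = 13 sqrt 13 r^3 / 48, with equality only for
the centroid of the two pieces of length r at a vertex and for the points of a
side whose disc of radius rho = sqrt 13 r / 4 does not cross the ends of that
side. Hence the unnormalized error is at least int g - n C = 13 r^2 / 8, whatever
the n points.
In the equality case the discs {|x - a|^2 < g} tile the boundary: this forces
the six centroids, and then the points of each side one after the other. *)

(** * A moment inequality for two segments meeting at 120 degrees *)

(** Complementary slackness dictates the constants. A corner point serves two pieces of length [r],
    a side point one piece of length [2 rho], and neighbouring points are equidistant from the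
    common end of their pieces. The centroid at a corner is at squared distance [13 r^2 / 16] from
    its two outer ends, whence [rho], and filling a side gives [2 r + 2 rho (k - 1) = 1]. Under a
    constant price a corner centroid would gain [13 r^3 / 12], more than a side point; lowering the
    price near the vertices with slope [c r] takes [c r^3] away from it, and equality of the two
    gains gives [c]. The obstacle is a point that straddles a vertex unevenly: its two pieces have
    arbitrary lengths, may start away from the vertex and may end on either part of the price. What
    makes this tractable is that the price is a minimum of three affine functions: on each side the
    gain is at most the integral, over one interval, of whichever of three quadratic polynomials is
    convenient. *)

Lemma straight_bound (R : realFieldType) (c S : R) :
  1 / 10 < c -> c < 1 / 9 -> 0 <= S ->
  (13 / 16 - c) * S + c * S ^+ 2 / 2 - S ^+ 3 / 12 < 13 / 12 - c.
Proof.
move=> c1 c2 S0.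
(* [19 / 10] is close to the maximizer in [S] of the left-hand side for the admissible slopes. *)
have h0 : 0 <= (S - 19 / 10) ^+ 2 * S by rewrite mulr_ge0// sqr_ge0.
have h1 : 0 <= (S - 19 / 10) ^+ 2 by rewrite sqr_ge0.
have h2 : 0 <= (1 / 9 - c) * S by rewrite mulr_ge0// subr_ge0 ltW.
have h3 : 0 <= (1 / 9 - c) * S ^+ 2 by rewrite mulr_ge0 ?sqr_ge0// subr_ge0 ltW.
nra.
Qed.

(** The case [a = b = S / 2] of the corner gain below; the double root [S = 2] is the optimal
    corner. The opposite extreme, a single piece of length [S] at the vertex, is
    [straight_bound]. *)
Lemma symmetric_bound (R : realFieldType) (c S : R) :
  13 / 12 - c - ((13 / 16 - c) * S + c * S ^+ 2 / 4 - 13 * S ^+ 3 / 192) =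
  (S - 2) ^+ 2 * (13 * S / 192 + (13 / 12 - c) / 4).
Proof. by field. Qed.

(** [M] is the gain, for [r = 1] and the linear price, of the centroid of two pieces of lengths [a]
    and [b] starting at the vertex. For a fixed sum it is a convex quadratic in
    [th = 4 a b / (a + b)^2], so it lies below its chord between [th = 0] ([straight_bound]) and
    [th = 1] ([symmetric_bound]). *)
Lemma corner_bound (R : realFieldType) (c a b : R) :
  1 / 10 < c -> c < 1 / 9 -> 0 < a -> 0 < b ->
  let M := 13 / 16 * (a + b) - (a + b) ^+ 3 / 12
           + (a * b) ^+ 2 / (4 * (a + b))
           - c * a * (1 - a / 2) - c * b * (1 - b / 2) in
  M <= 13 / 12 - c /\ (M = 13 / 12 - c -> a = 1 /\ b = 1).
Proof.
move=> c1 c2 a0 b0 M.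
set S := a + b; have S0 : 0 < S by rewrite addr_gt0.
have S0' : S != 0 by rewrite gt_eqF.
pose th := 4 * (a * b) / S ^+ 2.
have th0 : 0 < th by rewrite /th divr_gt0 ?mulr_gt0 ?exprn_gt0.
have abE : a * b = th * S ^+ 2 / 4 by rewrite /th; field.
have th1 : th <= 1.
  by rewrite /th ler_pdivrMr ?exprn_gt0// /S mul1r; have := sqr_ge0 (a - b); nra.
have ME : M = (13 / 16 - c) * S + c * (S ^+ 2 / 2 - th * S ^+ 2 / 4)
              - S ^+ 3 / 12 + th ^+ 2 * S ^+ 3 / 64.
  rewrite /M -/S abE.
  have -> : c * (S ^+ 2 / 2 - th * S ^+ 2 / 4) = c * ((a ^+ 2 + b ^+ 2) / 2).
    by rewrite -abE /S; field.
  by move: S0'; rewrite /S => ?; field.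
have st := straight_bound c1 c2 (ltW S0).
have sy := symmetric_bound c S.
set f0 := (X in X < _) in st.
set f1 := (X in _ - X) in sy.
set sq := (X in _ = X) in sy.
have sq0 : 0 <= sq by rewrite /sq mulr_ge0 ?sqr_ge0//; nra.
have S3 : 0 < S ^+ 3 by rewrite exprn_gt0.
have Mle : M <= (1 - th) * f0 + th * f1 - th * (1 - th) * S ^+ 3 / 64.
  rewrite ME /f0 /f1 le_eqVlt; apply/orP; left; apply/eqP; by field.
have t1 : 0 <= th * (1 - th) * S ^+ 3 by apply: mulr_ge0 (ltW S3); apply: mulr_ge0; rewrite ?subr_ge0 ?(ltW th0).
have t2 : 0 <= (1 - th) * (13 / 12 - c - f0) by rewrite mulr_ge0 ?subr_ge0 ?(ltW st).
have t3 : 0 <= th * sq by rewrite mulr_ge0 ?(ltW th0).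
have f1E : f1 = 13 / 12 - c - sq by lra.
move: Mle; rewrite f1E => Mle.
split; first by nra.
move=> MC.
have th1' : th = 1.
  (* If [th < 1], the strict slack of [straight_bound] has a positive weight in the chord. *)
  apply/eqP; rewrite eq_le th1 leNgt; apply/negP => th1'.
  have : 0 < (1 - th) * (13 / 12 - c - f0) by rewrite mulr_gt0 ?subr_gt0.
  by nra.
have : sq <= 0 by move: Mle; rewrite th1' MC; lra.
move=> sqle; have : sq == 0 by rewrite eq_le sqle.
rewrite /sq mulf_eq0 sqrf_eq0 => /orP[|]; last by nra.
rewrite subr_eq0 => /eqP S2.
move: abE; rewrite th1' S2 => ab1.
have ba : b = 2 - a by rewrite -S2 /S; ring.
have : (a - 1) ^+ 2 = 0 by rewrite ba in ab1; nra.
by move/eqP; rewrite sqrf_eq0 subr_eq0 => /eqP a1; rewrite ba a1; split; lra.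
Qed.

(* Two pieces of lengths a >= b on the two sides of a corner, at mean
   distances P and Q from it; c is the slope of the price g near the corner.
   The price is bounded above either by its maximum 13/16 or by its tangent. *)
Lemma wedge_core (R : realFieldType) (c a b P Q : R) :
  1 / 10 < c -> c < 1 / 9 ->
  (forall S, 0 <= S -> 13 / 16 * S - S ^+ 3 / 12 <= 13 / 12 - c) -> 0 < b -> b <= a ->
  a / 2 <= P -> b / 2 <= Q ->
  let A := 13 / 16 * (a + b) - a ^+ 3 / 12 - b ^+ 3 / 12
           - a * b / (a + b) * (P ^+ 2 + P * Q + Q ^+ 2) in
  [\/ A - c * a * (1 - P) - c * b * (1 - Q) <= 13 / 12 - c /\
      (A - c * a * (1 - P) - c * b * (1 - Q) = 13 / 12 - c ->
       [/\ a = 1, b = 1, P = 1 / 2 & Q = 1 / 2]),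
      A - c * b * (1 - Q) < 13 / 12 - c | A < 13 / 12 - c].
Proof.
move=> c1 c2 line b0 ba aP bQ A.
have a0 : 0 < a by lra.
(* How far the two pieces have slid away from the vertex; [B] below is the value of [A] when neither
   has. *)
pose u := P - a / 2; pose v := Q - b / 2.
have u0 : 0 <= u by rewrite subr_ge0.
have v0 : 0 <= v by rewrite subr_ge0.
have PE : P = a / 2 + u by rewrite /u; ring.
have QE : Q = b / 2 + v by rewrite /v; ring.
have ab0 : 0 < a + b by lra.
have ab0' : a + b != 0 by rewrite gt_eqF.
pose k := (a + b)^-1.
have k0 : 0 < k by rewrite invr_gt0.
have kab : k * (a + b) = 1 by rewrite mulVf.
pose B := 13 / 16 * (a + b) - (a + b) ^+ 3 / 12 + (a * b) ^+ 2 / (4 * (a + b)).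
have AE : A = B - k * a * b * (u ^+ 2 + u * v + v ^+ 2)
              - a * u * (k * (b * (a + b / 2))) - b * v * (k * (a * (b + a / 2))).
  by rewrite /A /B /k PE QE; field.
have uv0 : 0 <= k * a * b * (u ^+ 2 + u * v + v ^+ 2).
  by rewrite !mulr_ge0 ?(ltW a0) ?(ltW b0) ?(ltW k0)//; nra.
(* Per unit of length, sliding the first piece costs at least this rate in moment, while the linear
   price gives back only [c]. The next bounds are the same comparison for the second piece. *)
have coefa : 3 / 4 * b <= k * (b * (a + b / 2)).
  have -> : k * (b * (a + b / 2)) = 3 / 4 * b + k * b * ((a - b) / 4).
    by rewrite /k; field.
  by rewrite lerDl; apply: mulr_ge0; [apply: mulr_ge0; exact: ltW | lra].
have coefb : 1 / 2 * a <= k * (a * (b + a / 2)).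
  have -> : k * (a * (b + a / 2)) = 1 / 2 * a + k * a * b / 2.
    by rewrite /k; field.
  have : 0 <= k * a * b by rewrite !mulr_ge0 ?ltW.
  lra.
have coefb' : 3 / 4 * b <= k * (a * (b + a / 2)).
  have -> : k * (a * (b + a / 2)) = 3 / 4 * b + k * ((a * b + 2 * a ^+ 2 - 3 * b ^+ 2) / 4).
    by rewrite /k; field.
  by rewrite lerDl; apply: mulr_ge0; [exact: ltW | nra].
(* From [b = 1 / 6] on, both rates are at least [3 / 4 * b >= 1 / 8 > c]: sliding never pays and
   [corner_bound] decides. *)
have [bc|bc] := leP (1 / 6) b.
  apply: Or31.
  have [CM Ceq] := corner_bound c1 c2 a0 b0.
  set M := (X in X <= _) in CM.
  have ME : A - c * a * (1 - P) - c * b * (1 - Q) =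
     M - k * a * b * (u ^+ 2 + u * v + v ^+ 2)
       - a * u * (k * (b * (a + b / 2)) - c) - b * v * (k * (a * (b + a / 2)) - c).
    by rewrite AE /M /B /k PE QE; field.
  have eu : 0 < k * (b * (a + b / 2)) - c by nra.
  have ev : 0 < k * (a * (b + a / 2)) - c by nra.
  set e1 := (X in a * u * X) in ME; set e2 := (X in b * v * X) in ME.
  have h1 : 0 <= a * u * e1 by rewrite !mulr_ge0// ltW.
  have h2 : 0 <= b * v * e2 by rewrite !mulr_ge0// ltW.
  rewrite ME; split; first by lra.
  move=> E.
  have [a1 b1] : a = 1 /\ b = 1 by apply: Ceq; rewrite -/M; lra.
  have /eqP : a * u * e1 = 0 by lra.
  have /eqP : b * v * e2 = 0 by lra.
  rewrite !mulf_eq0 (gt_eqF b0) (gt_eqF a0) (gt_eqF eu) (gt_eqF ev) !orbF /=.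
  by move=> /eqP v00 /eqP u00; split => //; rewrite ?PE ?QE ?u00 ?v00 ?a1 ?b1; lra.
have Bt : (a * b) ^+ 2 / (4 * (a + b)) <= a * b ^+ 2 / 4.
  rewrite ler_pdivrMr ?mulr_gt0//.
  have : 0 <= a * b ^+ 3 by rewrite mulr_ge0 ?exprn_ge0// ltW.
  nra.
have v1 : 0 <= b * v by rewrite mulr_ge0// ltW.
have u1 : 0 <= a * u by rewrite mulr_ge0// ltW.
have Au : 0 <= a * u * (k * (b * (a + b / 2))) by rewrite mulr_ge0//; nra.
(* If also [a < 1 / 2], the total length is below [2 / 3] and the maximal price alone suffices. *)
have [a2|a2] := leP (1 / 2) a; last first.
  apply: Or33; rewrite AE /B.
  have Av : 0 <= b * v * (k * (a * (b + a / 2))) by rewrite mulr_ge0//; nra.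
  have : 0 <= (a + b) ^+ 3 by rewrite exprn_ge0// ltW.
  nra.
(* The long piece is charged the maximal price and the short one the linear price; the rate for the
   latter is at least [a / 2 >= 1 / 4 > c]. *)
apply: Or32; rewrite AE QE.
have Av : 0 <= b * v * (k * (a * (b + a / 2)) - c) by rewrite mulr_ge0//; lra.
suff : B - c * b * (1 - b / 2) < 13 / 12 - c by lra.
(* For [a <= 2] the correction [a b^2 / 4] is smaller than the price cut on the short piece. Beyond,
   the tangent at [S = 2] to the straight gain leaves just enough room. *)
rewrite /B; have [a3|a3] := leP a 2.
  have t1 : a * b ^+ 2 / 4 < c * b * (1 - b / 2) by nra.
  have := line (a + b) (ltW ab0).
  lra.
have : 0 <= c * b * (1 - b / 2) by rewrite !mulr_ge0//; lra.
set S := a + b; move=> ?.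
have S2 : 2 < S by rewrite /S; lra.
have St : 13 / 16 * S - S ^+ 3 / 12 <= 23 / 24 - 3 / 16 * (S - 2).
  have : 0 <= (S - 2) ^+ 2 * (S + 4) by rewrite mulr_ge0 ?sqr_ge0//; lra.
  nra.
have bb : b ^+ 2 <= 1 / 36 by nra.
have ab2 : a * b ^+ 2 <= a * (1 / 36) by rewrite ler_pM2l.
have aS : a < S by rewrite /S; lra.
lra.
Qed.

(* The integral of [al + be * x - x ^+ 2] over [s, t]. *)
Definition quad_int (R : realFieldType) (al be s t : R) : R :=
  al * (t - s) + be * (t ^+ 2 - s ^+ 2) / 2 - (t ^+ 3 - s ^+ 3) / 3.

Lemma quad_int_scale (R : realFieldType) (r al be s t : R) :
  quad_int (r ^+ 2 * al) (r * be) (r * s) (r * t) = r ^+ 3 * quad_int al be s t.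
Proof. by rewrite /quad_int; field. Qed.

(** [13 / 16 * r^2 * L - L^3 / 12] is the gain, at the maximal price, of the midpoint of a straight
    piece of length [L]. The factorization shows that its maximum over [L >= 0] is at the double
    root [L = w r / 2 = 2 rho]. *)
Lemma segment_cost (R : realFieldType) (r w L : R) : w ^+ 2 = 13 ->
  13 * w / 48 * r ^+ 3 - (13 / 16 * r ^+ 2 * L - L ^+ 3 / 12) =
  (L - w * r / 2) ^+ 2 * (L + w * r) / 12.
Proof. by move=> w2; rewrite -w2; field. Qed.

(** [H1] and [H2] stand for the gains of [(X, Y)] on the two sides of a vertex, for [r = 1];
    [z * Y - X] comes from the direction [(- 1 / 2, z / 2)] of the second side. By the parallel axis
    theorem the integral at the maximal price is its value [A] at the centroid of the two windows
    minus [dd], the total length times the squared distance to that centroid; [wedge_core] bounds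
    the rest. *)
Lemma wedge_unit (R : realFieldType) (w z X Y s1 t1 s2 t2 H1 H2 : R) :
  0 < w -> w ^+ 2 = 13 -> z ^+ 2 = 3 ->
  0 <= s1 -> s1 < t1 -> 0 <= s2 -> s2 < t2 ->
  let c := 13 / 48 * (4 - w) in
  let N := X ^+ 2 + Y ^+ 2 in
  H1 <= quad_int (13 / 16 - N) (2 * X) s1 t1 ->
  H1 <= quad_int (13 / 16 - c - N) (2 * X + c) s1 t1 ->
  H2 <= quad_int (13 / 16 - N) (z * Y - X) s2 t2 ->
  H2 <= quad_int (13 / 16 - c - N) (z * Y - X + c) s2 t2 ->
  H1 + H2 <= 13 * w / 48 /\
  (H1 + H2 = 13 * w / 48 -> X = 1 / 8 /\ Y = z / 8).
Proof.
move=> w0 w2 z2 s10 st1 s20 st2 c N.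
have w1 : 18 / 5 < w by rewrite -(@ltr_pXn2r _ 2) ?nnegrE ?w2 ?(ltW w0)//; lra.
have w3 : w < 29 / 8 by rewrite -(@ltr_pXn2r _ 2) ?nnegrE ?w2 ?(ltW w0)//; lra.
pose a := t1 - s1; pose b := t2 - s2.
pose P := (s1 + t1) / 2; pose Q := (s2 + t2) / 2.
have a0 : 0 < a by rewrite subr_gt0.
have b0 : 0 < b by rewrite subr_gt0.
have aP : a / 2 <= P by rewrite /a /P; lra.
have bQ : b / 2 <= Q by rewrite /b /Q; lra.
have quadE al be s t : quad_int al be s t =
   (t - s) * (al + be * ((s + t) / 2) - ((s + t) / 2) ^+ 2) - (t - s) ^+ 3 / 12.
  by rewrite /quad_int; field.
rewrite !quadE -/a -/b -/P -/Q => h1 h1' h2 h2'.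
pose A := 13 / 16 * (a + b) - a ^+ 3 / 12 - b ^+ 3 / 12
           - a * b / (a + b) * (P ^+ 2 + P * Q + Q ^+ 2).
pose d1 := (a + b) * X - a * P + b * Q / 2.
pose d2 := (a + b) * Y - z / 2 * (b * Q).
have ab0 : 0 < a + b by lra.
pose dd := (d1 ^+ 2 + d2 ^+ 2) / (a + b).
have dd0 : 0 <= dd by rewrite divr_ge0 ?(ltW ab0)// addr_ge0 ?sqr_ge0.
have AE : a * (13 / 16 - N + 2 * X * P - P ^+ 2) - a ^+ 3 / 12 +
  (b * (13 / 16 - N + (z * Y - X) * Q - Q ^+ 2) - b ^+ 3 / 12) = A - dd.
  have d2E : d2 ^+ 2 = ((a + b) * Y) ^+ 2 - z * (a + b) * Y * b * Q + z ^+ 2 * (b * Q) ^+ 2 / 4.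
    by rewrite /d2; field.
  by rewrite /dd d2E z2 /d1 /A /N; field; rewrite gt_eqF.
have c1 : 1 / 10 < c by rewrite /c; lra.
have c2 : c < 1 / 9 by rewrite /c; lra.
have CE : 13 / 12 - c = 13 * w / 48 by rewrite /c; field.
have line S : 0 <= S -> 13 / 16 * S - S ^+ 3 / 12 <= 13 / 12 - c.
  move=> S0; rewrite CE -subr_ge0; have := segment_cost 1 S w2.
  rewrite !expr1n !mulr1 => ->.
  by apply: mulr_ge0; [apply: mulr_ge0; [exact: sqr_ge0 | lra] | lra].
have e1 : H1 <= a * (13 / 16 - N + 2 * X * P - P ^+ 2) - a ^+ 3 / 12 - c * a * (1 - P) by nra.
have e2 : H2 <= b * (13 / 16 - N + (z * Y - X) * Q - Q ^+ 2) - b ^+ 3 / 12 - c * b * (1 - Q) by nra.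
(* [wedge_core] assumes [b <= a]; the third of the four alternatives is its second one with the
   sides exchanged. *)
suff key : [\/ A - c * a * (1 - P) - c * b * (1 - Q) <= 13 / 12 - c /\
      (A - c * a * (1 - P) - c * b * (1 - Q) = 13 / 12 - c ->
       [/\ a = 1, b = 1, P = 1 / 2 & Q = 1 / 2]),
      A - c * b * (1 - Q) < 13 / 12 - c, A - c * a * (1 - P) < 13 / 12 - c
      | A < 13 / 12 - c].
  rewrite -CE; case: key => [[M1 M2]|M|M|M]; split; try lra.
  move=> E; have [|a1 b1 P1 Q1] := M2; first by lra.
  have : dd = 0 by lra.
  move/eqP; rewrite mulf_eq0 invr_eq0 (gt_eqF ab0) orbF.
  rewrite paddr_eq0 ?sqr_ge0// !sqrf_eq0 /d1 /d2 a1 b1 P1 Q1 => /andP[/eqP ? /eqP ?].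
  by split; lra.
have [ba|ab] := leP b a.
  have [?|?|?] := wedge_core c1 c2 line b0 ba aP bQ; [exact: Or41|exact: Or42|exact: Or44].
have AS : A = 13 / 16 * (b + a) - b ^+ 3 / 12 - a ^+ 3 / 12
           - b * a / (b + a) * (Q ^+ 2 + Q * P + P ^+ 2).
  by rewrite /A [b + a]addrC; ring.
have := wedge_core c1 c2 line a0 (ltW ab) bQ aP; rewrite /= -AS => -[[M1 M2]|?|?].
- apply: Or41; split; first lra.
  by move=> E; have [|-> -> -> ->] := M2; first by lra.
- exact: Or43.
- exact: Or44.
Qed.

Lemma wedge_bound (R : realFieldType) (r w z X Y s1 t1 s2 t2 H1 H2 : R) :
  0 < r -> 0 < w -> w ^+ 2 = 13 -> z ^+ 2 = 3 ->
  0 <= s1 -> s1 < t1 -> 0 <= s2 -> s2 < t2 ->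
  let c := 13 / 48 * (4 - w) in
  let lam := 13 / 16 * r ^+ 2 in
  let N := X ^+ 2 + Y ^+ 2 in
  H1 <= quad_int (lam - N) (2 * X) s1 t1 ->
  H1 <= quad_int (lam - c * r ^+ 2 - N) (2 * X + c * r) s1 t1 ->
  H2 <= quad_int (lam - N) (z * Y - X) s2 t2 ->
  H2 <= quad_int (lam - c * r ^+ 2 - N) (z * Y - X + c * r) s2 t2 ->
  H1 + H2 <= 13 * w / 48 * r ^+ 3 /\
  (H1 + H2 = 13 * w / 48 * r ^+ 3 -> X = r / 8 /\ Y = z * r / 8).
Proof.
move=> r0 w0 w2 z2 s10 st1 s20 st2 c lam N.
have rn : r != 0 by rewrite gt_eqF.
have scale x : x = r * (x / r) by field.
have scale2 al be s t : quad_int al be s t =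
    r ^+ 3 * quad_int (al / r ^+ 2) (be / r) (s / r) (t / r).
  by rewrite -quad_int_scale; congr quad_int; field.
have r3 : 0 < r ^+ 3 by rewrite exprn_gt0.
rewrite (scale2 _ _ s1) (scale2 _ _ s1 t1) (scale2 _ _ s2) (scale2 _ _ s2 t2).
have div H q : H <= r ^+ 3 * q -> H / r ^+ 3 <= q by rewrite ler_pdivrMr// mulrC.
move=> /div h1 /div h1' /div h2 /div h2'; move: h1 h1' h2 h2'.
have s10' : 0 <= s1 / r by rewrite divr_ge0// ltW.
have s20' : 0 <= s2 / r by rewrite divr_ge0// ltW.
have st1' : s1 / r < t1 / r by rewrite ltr_pM2r ?invr_gt0.
have st2' : s2 / r < t2 / r by rewrite ltr_pM2r ?invr_gt0.
have := @wedge_unit R w z (X / r) (Y / r) _ _ _ _ (H1 / r ^+ 3) (H2 / r ^+ 3)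
  w0 w2 z2 s10' st1' s20' st2'.
rewrite /= -/c.
have -> : 13 / 16 - ((X / r) ^+ 2 + (Y / r) ^+ 2) = (lam - N) / r ^+ 2.
  by rewrite /lam /N; field.
have -> : 13 / 16 - c - ((X / r) ^+ 2 + (Y / r) ^+ 2) = (lam - c * r ^+ 2 - N) / r ^+ 2.
  by rewrite /lam /N; field.
have -> : z * (Y / r) - X / r + c = (z * Y - X + c * r) / r by field.
have -> : z * (Y / r) - X / r = (z * Y - X) / r by field.
have -> : 2 * (X / r) + c = (2 * X + c * r) / r by field.
have -> : 2 * (X / r) = (2 * X) / r by field.
move=> W h1 h1' h2 h2'; have [M E] := W h1 h1' h2 h2'.
have Hs : H1 + H2 = (H1 / r ^+ 3 + H2 / r ^+ 3) * r ^+ 3 by field.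
rewrite Hs; split; first by rewrite ler_pM2r.
move/(mulIf (lt0r_neq0 r3)) => /E [Xr Yr].
by rewrite (scale X) (scale Y) Xr Yr; split; field.
Qed.

(** * Frames of the hexagon *)

Definition sqdist (R : realType) (x a : plane R) : R :=
  (x.1 - a.1) ^+ 2 + (x.2 - a.2) ^+ 2.

Definition hex_side (R : realType) (i : nat) (t : R) : plane R :=
  seg_param (hexv R i) (hexv R i.+1) t.

(* Coordinates of [a] in the orthonormal frame with origin the [i]-th vertex
   and first axis along the [i]-th side, the hexagon lying above it. *)
Definition hex_frame (R : realType) (i : nat) (a : plane R) : plane R :=
  let d := hexv R i.+1 - hexv R i in
  let u := a - hexv R i in
  (d.1 * u.1 + d.2 * u.2, d.1 * u.2 - d.2 * u.1).

Lemma sqrt3_sqr (R : realType) : Num.sqrt 3 ^+ 2 = 3 :> R.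
Proof. by rewrite sqr_sqrtr. Qed.

Lemma hexv_mod (R : realType) i : hexv R (i %% 6) = hexv R i.
Proof. by rewrite /hexv modn_mod. Qed.

Lemma hex_side_mod (R : realType) i (t : R) : hex_side (i %% 6) t = hex_side i t.
Proof.
rewrite /hex_side hexv_mod; congr (seg_param _ _ t).
by rewrite /hexv -(addn1 (i %% 6)) -(addn1 i) modnDml.
Qed.

Lemma hex_frame_mod (R : realType) i (a : plane R) :
  hex_frame (i %% 6) a = hex_frame i a.
Proof.
rewrite /hex_frame hexv_mod; have -> // : hexv R (i %% 6).+1 = hexv R i.+1.
by rewrite /hexv -(addn1 (i %% 6)) -(addn1 i) modnDml.
Qed.

Lemma hex_side_coord (R : realType) j (t : R) : (j < 6)%N ->
  hex_side j t =
  nth (0, 0) [:: (t, 0);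
    (1 + t / 2, Num.sqrt 3 * t / 2);
    (3 / 2 - t / 2, Num.sqrt 3 / 2 + Num.sqrt 3 * t / 2);
    (1 - t, Num.sqrt 3);
    (- (t / 2), Num.sqrt 3 - Num.sqrt 3 * t / 2);
    (- ((1 - t) / 2), Num.sqrt 3 * (1 - t) / 2)] j.
Proof.
rewrite /hex_side /seg_param /hexv.
by case: j => [|[|[|[|[|[|//]]]]]] _ /=; congr pair; field.
Qed.

Lemma sqdist_frame (R : realType) i (x a : plane R) :
  sqdist (hex_frame i x) (hex_frame i a) = sqdist x a.
Proof.
rewrite -hex_frame_mod -(hex_frame_mod i a) /hex_frame.
set d := hexv R _ - _.
have d1 : d.1 ^+ 2 + d.2 ^+ 2 = 1.
  have := sqrt3_sqr R; have : (i %% 6 < 6)%N by rewrite ltn_mod.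
  rewrite /d; case: (i %% 6)%N => [|[|[|[|[|[|//]]]]]] _;
    rewrite /hexv /=; set z := Num.sqrt 3 => z2; lra.
by rewrite /sqdist -[RHS]mul1r -d1 /=; ring.
Qed.

(** A change of frame is a rotation of the hexagon that shifts the indices, so every estimate
    between two sides can be made with side [0] as one of them. *)
Lemma hex_frame_vertex (R : realType) i j :
  hex_frame i (hexv R (i + j)) = hexv R j.
Proof.
rewrite -hex_frame_mod -(hexv_mod _ (i + j)) -modnDm hexv_mod -(hexv_mod _ j).
have := sqrt3_sqr R.
have : (i %% 6 < 6)%N by rewrite ltn_mod.
have : (j %% 6 < 6)%N by rewrite ltn_mod.
by case: (i %% 6)%N => [|[|[|[|[|[|//]]]]]];
 case: (j %% 6)%N => [|[|[|[|[|[|//]]]]]] _ _;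
  rewrite /hex_frame /hexv /=; set z := Num.sqrt 3 => z2; congr pair; lra.
Qed.

Lemma hex_frame_side (R : realType) i j (t : R) :
  hex_frame i (hex_side (i + j) t) = hex_side j t.
Proof.
rewrite {2}/hex_side -(hex_frame_vertex R i j) -(hex_frame_vertex R i j.+1) addnS.
rewrite /hex_side /hex_frame /seg_param /=.
by congr pair; ring.
Qed.

Lemma sqdist_ge0 (R : realType) (x a : plane R) : 0 <= sqdist x a.
Proof. by rewrite addr_ge0 ?sqr_ge0. Qed.

Lemma sqdist0_eq (R : realType) (x a : plane R) : sqdist x a = 0 -> x = a.
Proof.
case: x a => x1 x2 [a1 a2] /eqP; rewrite /sqdist paddr_eq0 ?sqr_ge0//=.
by rewrite !sqrf_eq0 !subr_eq0 => /andP[/eqP -> /eqP ->].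
Qed.

Lemma hex_frame_inj (R : realType) i : injective (@hex_frame R i).
Proof.
move=> a b ab; apply: sqdist0_eq.
by rewrite -(sqdist_frame i) ab /sqdist !subrr expr0n addr0.
Qed.

Lemma sqdist_side (R : realType) i (t : R) (a : plane R) :
  sqdist (hex_side i t) a =
  (t - (hex_frame i a).1) ^+ 2 + (hex_frame i a).2 ^+ 2.
Proof.
rewrite -(sqdist_frame i); have := hex_frame_side i 0 t; rewrite addn0 => ->.
by rewrite hex_side_coord//= /sqdist /= sub0r sqrrN.
Qed.

(** [i + 5] is [i - 1] modulo 6, and the parameter [1 - t] makes [t] the distance to the shared
    vertex. *)
Lemma sqdist_prev_side (R : realType) i (t : R) (a : plane R) :
  sqdist (hex_side (i + 5) (1 - t)) a =
  (- (t / 2) - (hex_frame i a).1) ^+ 2 +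
  (Num.sqrt 3 * t / 2 - (hex_frame i a).2) ^+ 2.
Proof.
rewrite -(sqdist_frame i) hex_frame_side hex_side_coord//= /sqdist/=.
by congr (_ ^+ 2 + _ ^+ 2); field.
Qed.

Lemma opposite_sides_far (R : realType) i j (x y : R) : (1 < j < 5)%N ->
  0 <= x <= 1 -> 0 <= y <= 1 -> 1 <= sqdist (hex_side i x) (hex_side (i + j) y).
Proof.
move=> j25 /andP[x0 x1] /andP[y0 y1].
have f0 := hex_frame_side i 0 x; rewrite addn0 in f0.
rewrite -(sqdist_frame i) hex_frame_side f0.
rewrite !hex_side_coord//; last by case/andP: j25 => _ /ltn_trans; apply.
have := sqrt3_sqr R; rewrite /sqdist.
case: j j25 => [|[|[|[|[|//]]]]] // _ /=; set z := Num.sqrt 3 => z2; nra.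
Qed.

Lemma sqdist_triangle (R : realType) (x y a : plane R) :
  sqdist x y <= 2 * (sqdist x a + sqdist y a).
Proof.
rewrite /sqdist.
have := sqr_ge0 (x.1 - a.1 + (y.1 - a.1)).
have := sqr_ge0 (x.2 - a.2 + (y.2 - a.2)).
nra.
Qed.

(** * Integrals of continuous functions *)

Lemma continuous_integrable_itv (R : realType) (f : R -> R) (a b : R) :
  continuous f -> (@lebesgue_measure R).-integrable `[a, b] (EFin \o f).
Proof.
move=> cf; apply: continuous_compact_integrable; first exact: segment_compact.
exact: continuous_subspaceT.
Qed.

Lemma continuous_quadratic (R : realType) (al be ga : R) :
  continuous (fun x : R => al + be * x - ga * x ^+ 2).
Proof.
have -> : (fun x : R => al + be * x - ga * x ^+ 2) =
    horner (al%:P + be%:P * 'X - ga%:P * 'X^2).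
  by apply/funext => x; rewrite !hornerE.
exact: continuous_horner.
Qed.

Lemma Rintegral_quadratic (R : realType) (al be ga s t : R) : s <= t ->
  \int[@lebesgue_measure R]_(x in `[s, t]) (al + be * x - ga * x ^+ 2) =
  al * (t - s) + be * (t ^+ 2 - s ^+ 2) / 2 - ga * (t ^+ 3 - s ^+ 3) / 3.
Proof.
rewrite le_eqVlt => /predU1P[->|st].
  by rewrite set_itv1 Rintegral_set1 !subrr !(mulr0, mul0r, subr0, addr0).
pose p : {poly R} := al%:P * 'X + (be / 2)%:P * 'X^2 - (ga / 3)%:P * 'X^3.
have pE x : p.[x] = al * x + be / 2 * x ^+ 2 - ga / 3 * x ^+ 3.
  by rewrite /p !hornerE.
have := @continuous_FTC2 R (fun x : R => al + be * x - ga * x ^+ 2) (horner p) s t st.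
rewrite /Rintegral => -> /=.
- by rewrite !pE; field.
- by apply: continuous_subspaceT; exact: continuous_quadratic.
- split => [x _||]; first exact: derivable_horner.
    by apply: cvg_at_right_filter; exact: continuous_horner.
  by apply: cvg_at_left_filter; exact: continuous_horner.
- by move=> x _; rewrite -derivE /p !poly.derivE !hornerE /=; field.
Qed.

Lemma Rintegral_itv_cat (R : realType) (f : R -> R) (a b c : R) :
  continuous f -> a <= b -> b <= c ->
  \int[@lebesgue_measure R]_(x in `[a, c]) f x =
  \int[@lebesgue_measure R]_(x in `[a, b]) f x +
  \int[@lebesgue_measure R]_(x in `[b, c]) f x.
Proof.
move=> cf ab bc; apply/eqP; rewrite addrC -subr_eq; apply/eqP.
rewrite Rintegral_itvB ?bnd_simp//; last exact: continuous_integrable_itv.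
rewrite Rintegral_itv_obnd_cbnd//.
apply: integrableS (continuous_integrable_itv b c cf) => //.
exact: subset_itv_oc_cc.
Qed.

Lemma Rintegral_eq0_continuous (R : realType) (f : R -> R) (a b : R) :
  a < b -> continuous f -> (forall x, a <= x <= b -> 0 <= f x) ->
  \int[@lebesgue_measure R]_(x in `[a, b]) f x = 0 ->
  forall x, a <= x <= b -> f x = 0.
Proof.
move=> ab cf f0 If x /andP[ax xb]; apply/eqP; rewrite eq_le f0 ?ax// andbT leNgt.
apply/negP => fx0.
have /cvgrPdist_lt /(_ (f x / 2)) : f @ x --> f x := cf x.
rewrite divr_gt0// => /(_ isT) [e /= e0 He].
pose c := Num.max a (x - e / 2); pose d := Num.min b (x + e / 2).
have cd : c < d by rewrite /c /d lt_min !gt_max; do !(apply/andP; split); lra.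
have ac : a <= c by rewrite /c le_max lexx.
have db : d <= b by rewrite /d ge_min lexx.
have fcd y : c <= y <= d -> f x / 2 <= f y.
  move=> /andP[]; rewrite /c /d ge_max le_min => /andP[_ y1] /andP[_ y2].
  have : ball_ Num.norm x e y by rewrite /= ltr_norml; apply/andP; split; lra.
  by move/He => /=; rewrite ltr_norml => /andP[_]; lra.
have int0 s t : a <= s -> t <= b -> 0 <= \int[@lebesgue_measure R]_(x in `[s, t]) f x.
  move=> as_ tb; apply: Rintegral_ge0 => y; rewrite /= in_itv/= => /andP[sy yt].
  by apply: f0; rewrite (le_trans as_)//= (le_trans yt).
have := Rintegral_itv_cat cf ac (le_trans (ltW cd) db).
rewrite (Rintegral_itv_cat cf (ltW cd) db) If.
have : (f x / 2) * (d - c) <= \int[@lebesgue_measure R]_(x in `[c, d]) f x.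
  have <- : \int[@lebesgue_measure R]_(y in `[c, d]) (f x / 2) = (f x / 2) * (d - c).
    rewrite Rintegral_cst//=. rewrite lebesgue_measure_itv/= lte_fin cd.
    by rewrite -EFinD /=.
  apply: le_Rintegral => //.
  - by apply: continuous_integrable_itv => y; exact: cvg_cst.
  - exact: continuous_integrable_itv.
have pos : 0 < f x / 2 * (d - c) by rewrite mulr_gt0 ?subr_gt0 ?divr_gt0.
move=> /(lt_le_trans pos) p1; apply/eqP; rewrite lt_eqF// ltr_wpDl//.
  exact: int0 (lexx _) (le_trans (ltW cd) db).
by rewrite ltr_pwDl//; exact: int0 (le_trans ac (ltW cd)) (lexx _).
Qed.

Lemma quadratic_nonneg_itv (R : realType) (al be : R) :
  exists l h, forall x, (0 <= al + be * x - x ^+ 2) = (l <= x <= h).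
Proof.
have [D0|D0] := leP 0 (al + be ^+ 2 / 4); last first.
  (* Without real roots the answer is an empty interval. *)
  exists 1, 0 => x; apply/idP/idP; last by move=> /andP[]; lra.
  by have := sqr_ge0 (x - be / 2); nra.
pose q := Num.sqrt (al + be ^+ 2 / 4).
have q0 : 0 <= q by rewrite sqrtr_ge0.
have q2 : q ^+ 2 = al + be ^+ 2 / 4 by rewrite sqr_sqrtr.
exists (be / 2 - q), (be / 2 + q) => x.
have -> : al + be * x - x ^+ 2 = (x - (be / 2 - q)) * ((be / 2 + q) - x).
  have -> : al = q ^+ 2 - be ^+ 2 / 4 by lra.
  by field.
apply/idP/idP => [h|/andP[h1 h2]]; last by rewrite mulr_ge0// subr_ge0.
by apply/andP; split; rewrite leNgt; apply/negP => h1; nra.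
Qed.

(** Each concave parabola is nonnegative on an interval, so the three are jointly nonnegative on one
    window [[s, t]]. There the integrand is their minimum, hence below each of them; elsewhere it is
    zero. *)
Lemma window_bound (R : realType) (al1 be1 al2 be2 al3 be3 : R) :
  let u1 x := al1 + be1 * x - x ^+ 2 in
  let u2 x := al2 + be2 * x - x ^+ 2 in
  let u3 x := al3 + be3 * x - x ^+ 2 in
  let F := \int[@lebesgue_measure R]_(x in `[0, 1])
              Num.max 0 (Num.min (u1 x) (Num.min (u2 x) (u3 x))) in
  exists s t, [/\ 0 <= s, s <= t, t <= 1, s < t -> 0 <= u1 s &
    [/\ F <= quad_int al1 be1 s t, F <= quad_int al2 be2 s t
      & F <= quad_int al3 be3 s t]].
Proof.
move=> u1 u2 u3 F.
have [l1 [h1 H1]] := quadratic_nonneg_itv al1 be1.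
have [l2 [h2 H2]] := quadratic_nonneg_itv al2 be2.
have [l3 [h3 H3]] := quadratic_nonneg_itv al3 be3.
pose w x := Num.min (u1 x) (Num.min (u2 x) (u3 x)).
pose s := Num.max 0 (Num.max l1 (Num.max l2 l3)).
pose t := Num.min 1 (Num.min h1 (Num.min h2 h3)).
have wP x : 0 <= x <= 1 -> (0 <= w x) = (s <= x <= t).
  move=> /andP[x0 x1]; rewrite /w /= ?le_min ?H1 ?H2 ?H3 ?ge_max ?le_min x0 x1 /=.
  by case: (l1 <= x); case: (l2 <= x); case: (l3 <= x); case: (x <= h1); case: (x <= h2).
have cu al be : continuous (fun x : R => al + be * x - x ^+ 2).
  by have := @continuous_quadratic R al be 1; under eq_fun do rewrite mul1r.
have cw : continuous (fun x => Num.max 0 (w x)).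
  move=> x; apply: continuous_max; first exact: cvg_cst.
  apply: continuous_min; first exact: cu.
  by apply: continuous_min; exact: cu.
have [st|ts] := leP s t; last first.
  have F0 : F = 0.
    transitivity (\int[@lebesgue_measure R]_(x in `[0, 1]) (cst 0 x)); last first.
      by rewrite Rintegral_cst// mul0r.
    apply: eq_Rintegral => x; rewrite inE /= in_itv/= => x01.
    rewrite max_l// ltW// ltNge -/(w x) wP//; apply/negP => /andP[sx xt].
    by have := lt_le_trans ts (le_trans sx xt); rewrite ltxx.
  (* An empty window is replaced by a degenerate one, over which the three integrals are zero. *)
  by exists 0, 0; split => //; rewrite ?ltxx// F0 /quad_int !subrr !(mulr0, mul0r, addr0, subr0).
have s0 : 0 <= s by rewrite /s le_max lexx.
have t1 : t <= 1 by rewrite /t ge_min lexx.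
have FE : F = \int[@lebesgue_measure R]_(x in `[s, t]) Num.max 0 (w x).
  have -> : [set` `[s, t]] = `[0, 1] `&` `[s, t].
    rewrite setIidr//; apply: subset_itv; rewrite bnd_simp//.
  rewrite Rintegral_mkcondr; apply: eq_Rintegral => x.
  rewrite inE /= in_itv/= patchE => x01.
  case: ifPn => //; rewrite notin_setE /= in_itv/= -wP// => /negP.
  by rewrite -ltNge => wx; rewrite max_l// ltW.
have ws x : s <= x <= t -> 0 <= w x.
  move=> /andP[sx xt]; rewrite wP ?sx ?xt//.
  by rewrite (le_trans s0 sx) (le_trans xt t1).
have Fle al be : (forall x, w x <= al + be * x - x ^+ 2) -> F <= quad_int al be s t.
  move=> wu; have <- : \int[@lebesgue_measure R]_(x in `[s, t]) (al + be * x - x ^+ 2) =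
      quad_int al be s t.
    have := Rintegral_quadratic al be 1 st.
    by under eq_Rintegral do rewrite mul1r; rewrite mul1r.
  rewrite FE; apply: le_Rintegral => //.
  - exact: continuous_integrable_itv.
  - by apply: continuous_integrable_itv; exact: cu.
  - move=> x; rewrite /= in_itv/= => xst.
    by rewrite max_r ?ws.
exists s, t; split => //.
  by move=> _; have := ws s; rewrite lexx st /w le_min => /(_ isT) /andP[].
split; apply: Fle => x; rewrite /w.
- by rewrite ge_min lexx.
- by rewrite !ge_min lexx orbT.
- by rewrite !ge_min lexx !orbT.
Qed.

(** * The gain of a point *)

Definition corner_slope (R : realType) : R := 13 / 48 * (4 - Num.sqrt 13).

(** Written as a minimum and not by cases, so that each affine piece is an upper bound on the whole
    side, as [window_bound] requires. *)
Definition price (R : realType) (r t : R) : R :=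
  let lam := 13 / 16 * r ^+ 2 in let c := corner_slope R in
  Num.min lam (Num.min (lam - c * r ^+ 2 + c * r * t)
                       (lam - c * r ^+ 2 + c * r * (1 - t))).

Definition side_gain (R : realType) (r : R) (a : plane R) (i : nat) : R :=
  \int[@lebesgue_measure R]_(t in `[0, 1])
    Num.max 0 (price r t - sqdist (hex_side i t) a).

Definition max_gain (R : realType) (r : R) : R := 13 * Num.sqrt 13 / 48 * r ^+ 3.

Lemma sqrt13_sqr (R : realType) : Num.sqrt 13 ^+ 2 = 13 :> R.
Proof. by rewrite sqr_sqrtr. Qed.

Lemma sqrt13_gt0 (R : realType) : 0 < Num.sqrt 13 :> R.
Proof. by rewrite sqrtr_gt0. Qed.

Lemma sqrt13_bounds (R : realType) : 18 / 5 < Num.sqrt 13 :> R /\ Num.sqrt 13 < 29 / 8 :> R.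
Proof.
have w0 := ltW (sqrt13_gt0 R).
by split; rewrite -(@ltr_pXn2r _ 2) ?nnegrE ?sqrt13_sqr//; lra.
Qed.

Lemma corner_slope_bounds (R : realType) : 1 / 10 < corner_slope R < 1 / 9.
Proof. by have [? ?] := sqrt13_bounds R; rewrite /corner_slope; apply/andP; split; lra. Qed.

(** The substitution [x -> 1 - x], by which a window on the previous side is measured from the
    shared vertex. *)
Lemma quad_int_flip (R : realType) (al be s t : R) :
  quad_int al be s t = quad_int (al + be - 1) (2 - be) (1 - t) (1 - s).
Proof. by rewrite /quad_int; field. Qed.

Lemma quad_int_nil (R : realType) (al be s : R) : quad_int al be s s = 0.
Proof. by rewrite /quad_int !subrr !(mulr0, mul0r, subr0, addr0). Qed.

Lemma side_gain_window (R : realType) (r : R) (a : plane R) i :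
  let lam := 13 / 16 * r ^+ 2 in let c := corner_slope R in
  let p := hex_frame i a in let N := p.1 ^+ 2 + p.2 ^+ 2 in
  exists s t, [/\ 0 <= s, s <= t, t <= 1,
     s < t -> sqdist (hex_side i s) a <= lam &
    [/\ side_gain r a i <= quad_int (lam - N) (2 * p.1) s t,
        side_gain r a i <= quad_int (lam - c * r ^+ 2 - N) (2 * p.1 + c * r) s t &
        side_gain r a i <=
          quad_int (lam - c * r ^+ 2 + c * r - N) (2 * p.1 - c * r) s t]].
Proof.
move=> lam c p N.
have [s [t [s0 st t1 near bounds]]] := window_bound (lam - N) (2 * p.1)
  (lam - c * r ^+ 2 - N) (2 * p.1 + c * r)
  (lam - c * r ^+ 2 + c * r - N) (2 * p.1 - c * r).
exists s, t; split => //.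
  by move=> /near; rewrite sqdist_side -/p /N; nra.
suff -> : side_gain r a i = \int[@lebesgue_measure R]_(x in `[0, 1])
    Num.max 0 (Num.min (lam - N + 2 * p.1 * x - x ^+ 2)
     (Num.min (lam - c * r ^+ 2 - N + (2 * p.1 + c * r) * x - x ^+ 2)
        (lam - c * r ^+ 2 + c * r - N + (2 * p.1 - c * r) * x - x ^+ 2))) by [].
apply: eq_Rintegral => x _; congr Num.max.
rewrite sqdist_side -/p /price -/lam -/c !addr_minl.
by congr Num.min; [|congr Num.min]; rewrite /N; ring.
Qed.

Lemma side_gain_near (R : realType) (r : R) (a : plane R) i : 0 < side_gain r a i ->
  exists2 x, 0 <= x <= 1 & sqdist (hex_side i x) a <= 13 / 16 * r ^+ 2.
Proof.
have [s [t [s0 + t1 near [b1 _ _]]]] := side_gain_window r a i.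
rewrite le_eqVlt => /predU1P[st|st] G0.
  by move: b1; rewrite st quad_int_nil leNgt G0.
by exists s; [rewrite s0 (le_trans (ltW st))|exact: near].
Qed.

(** Two boundary points within [rho] of [a] are at squared distance at most
    [4 * (13 / 16) * r^2 <= 13 / 16], whereas non-adjacent sides are at distance at least 1. *)
Lemma side_gain_opposite (R : realType) (r : R) (a : plane R) i j : 0 < r -> r <= 1 / 2 ->
  (1 < j < 5)%N -> 0 < side_gain r a i -> side_gain r a (i + j) <= 0.
Proof.
move=> r0 r2 j25 /side_gain_near[x x01 xa]; rewrite leNgt; apply/negP.
move=> /side_gain_near[y y01 ya].
have := opposite_sides_far i j25 x01 y01.
have := sqdist_triangle (hex_side i x) (hex_side (i + j) y) a.
have : r ^+ 2 <= 1 / 4 by nra.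
lra.
Qed.

Lemma side_gain_single (R : realType) (r : R) (a : plane R) i : 0 < r ->
  side_gain r a i <= max_gain r /\
  (side_gain r a i = max_gain r ->
   exists p, [/\ Num.sqrt 13 / 4 * r <= p, p <= 1 - Num.sqrt 13 / 4 * r &
     hex_frame i a = (p, 0)]).
Proof.
move=> r0; have [s [t [s0 st t1 _ [b1 _ _]]]] := side_gain_window r a i.
move: b1; set X := (hex_frame i a).1; set Y := (hex_frame i a).2.
set w := Num.sqrt 13; set L := t - s; set P := (s + t) / 2.
have w2 : w ^+ 2 = 13 by exact: sqrt13_sqr.
have w0 : 0 < w by exact: sqrt13_gt0.
have L0 : 0 <= L by rewrite subr_ge0.
(* Three losses: a window of the wrong length, a point off the line of the side, a point off the
   middle of its window. When all vanish the window is [[p - rho, p + rho]], whose inclusion in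
   [[0, 1]] gives the two bounds on [p]. *)
have -> : quad_int (13 / 16 * r ^+ 2 - (X ^+ 2 + Y ^+ 2)) (2 * X) s t =
   max_gain r - (L - w * r / 2) ^+ 2 * (L + w * r) / 12 - L * (Y ^+ 2 + (X - P) ^+ 2).
  by rewrite -segment_cost// /max_gain -/w /quad_int /L /P; field.
have wr0 : 0 < w * r by rewrite mulr_gt0.
have e1 : 0 <= (L - w * r / 2) ^+ 2 * (L + w * r).
  by apply: mulr_ge0; [exact: sqr_ge0 | lra].
have e2 : 0 <= L * (Y ^+ 2 + (X - P) ^+ 2) by rewrite mulr_ge0// addr_ge0 ?sqr_ge0.
move=> G; split; first by lra.
move=> GE.
have /eqP : (L - w * r / 2) ^+ 2 * (L + w * r) = 0 by lra.
rewrite mulf_eq0 sqrf_eq0 (gt_eqF (_ : 0 < L + w * r)) ?ltr_wpDl// orbF subr_eq0 => /eqP LE.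
have /eqP : L * (Y ^+ 2 + (X - P) ^+ 2) = 0 by lra.
rewrite mulf_eq0 LE gt_eqF ?divr_gt0//= paddr_eq0 ?sqr_ge0// !sqrf_eq0.
move=> /andP[/eqP Y0 /eqP XP0]; have XP : X = P by lra.
exists X; split.
- by rewrite XP /P; move: LE; rewrite /L; lra.
- by rewrite XP /P; move: LE; rewrite /L; lra.
- by rewrite -Y0 /X /Y; case: (hex_frame i a).
Qed.

Lemma side_gain_corner (R : realType) (r : R) (a : plane R) i : 0 < r ->
  0 < side_gain r a i -> 0 < side_gain r a (i + 5) ->
  side_gain r a i + side_gain r a (i + 5) <= max_gain r /\
  (side_gain r a i + side_gain r a (i + 5) = max_gain r ->
   hex_frame i a = (r / 8, Num.sqrt 3 * r / 8)).
Proof.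
move=> r0 G1 G2.
have [s1 [t1 [s10 + t11 _ [b1 b2 _]]]] := side_gain_window r a i.
rewrite le_eqVlt => /predU1P[st|st1].
  by move: b1; rewrite st quad_int_nil leNgt G1.
have [s2 [t2 [s20 + t21 _ [b3 _ b4]]]] := side_gain_window r a (i + 5).
rewrite le_eqVlt => /predU1P[st|st2].
  by move: b3; rewrite st quad_int_nil leNgt G2.
have q t := sqdist_prev_side i t a.
have := q 0; have := q 1; rewrite !sqdist_side.
move: b1 b2 b3 b4; set c := corner_slope R; set lam := 13 / 16 * r ^+ 2.
set z := Num.sqrt 3; set X := (hex_frame i a).1; set Y := (hex_frame i a).2.
set X' := (hex_frame (i + 5) a).1; set Y' := (hex_frame (i + 5) a).2.
have z2 : z ^+ 2 = 3 by exact: sqrt3_sqr.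
rewrite [quad_int _ _ s2 t2]quad_int_flip [quad_int (_ + _ - _) _ s2 t2]quad_int_flip.
move=> b1 b2 b3 b4 q1 q0.
(* [q0] and [q1] compare in both frames the distances from [a] to the ends of the previous side;
   together they yield the change of coordinates between the two frames. *)
have XE : 2 - 2 * X' = z * Y - X by nra.
have NE : 2 * X' - (X' ^+ 2 + Y' ^+ 2) - 1 = - (X ^+ 2 + Y ^+ 2) by nra.
have := @wedge_bound R r (Num.sqrt 13) z X Y s1 t1 (1 - t2) (1 - s2)
  (side_gain r a i) (side_gain r a (i + 5)) r0 (sqrt13_gt0 R) (sqrt13_sqr R) z2 s10 st1.
rewrite subr_ge0 t21 => /(_ isT); rewrite ltrD2l ltrN2 st2 => /(_ isT).
rewrite /= -/c -/lam => /(_ b1 b2).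
have -> : lam - (X ^+ 2 + Y ^+ 2) = lam - (X' ^+ 2 + Y' ^+ 2) + 2 * X' - 1 by lra.
have -> : lam - c * r ^+ 2 - (X ^+ 2 + Y ^+ 2) =
  lam - c * r ^+ 2 + c * r - (X' ^+ 2 + Y' ^+ 2) + (2 * X' - c * r) - 1 by lra.
rewrite -XE; have -> : 2 - 2 * X' + c * r = 2 - (2 * X' - c * r) by ring.
move=> /(_ b3 b4)[M E]; split => // /E [X8 Y8].
by rewrite -X8 -Y8 /X /Y; case: (hex_frame i a).
Qed.

Lemma sum_cyclic6 (R : realType) (f : nat -> R) i :
  (forall j, f (j %% 6)%N = f j) -> \sum_(j < 6) f j = \sum_(j < 6) f (i + j)%N.
Proof.
move=> fm; rewrite [RHS](eq_bigr (fun j : 'I_6 => f ((i %% 6 + j) %% 6)%N)); last first.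
  by move=> j _; rewrite modnDml fm.
rewrite !big_ord_recl !big_ord0 /= /bump /=.
have : (i %% 6 < 6)%N by rewrite ltn_mod.
by case: (i %% 6)%N => [|[|[|[|[|[|//]]]]]] _ /=; rewrite /bump /=; ring.
Qed.

Lemma side_gain_mod (R : realType) (r : R) (a : plane R) i :
  side_gain r a (i %% 6) = side_gain r a i.
Proof. by apply: eq_Rintegral => t _; rewrite hex_side_mod. Qed.

(* A disc of radius [sqrt 13 / 4 * r < 1 / 2] meets at most two sides, and these
   are adjacent. *)
Lemma total_gain_bound (R : realType) (r : R) (a : plane R) : 0 < r -> r <= 1 / 2 ->
  \sum_(i < 6) side_gain r a i <= max_gain r /\
  (\sum_(i < 6) side_gain r a i = max_gain r ->
   exists i, hex_frame i a = (r / 8, Num.sqrt 3 * r / 8) \/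
     exists p, [/\ Num.sqrt 13 / 4 * r <= p, p <= 1 - Num.sqrt 13 / 4 * r &
       hex_frame i a = (p, 0)]).
Proof.
move=> r0 r2.
have C0 : 0 < max_gain r.
  by rewrite /max_gain !(mulr_gt0, divr_gt0, exprn_gt0)// ?sqrt13_gt0.
have [[i Gi]|none] := pselect (exists i, 0 < side_gain r a i); last first.
  have S0 : \sum_(i < 6) side_gain r a i <= 0.
    by apply: sumr_le0 => i _; rewrite leNgt; apply/negP => G; apply: none; exists i.
  by split; [exact: le_trans (ltW C0)|move=> E; move: S0; rewrite E leNgt C0].
have far j : (1 < j < 5)%N -> side_gain r a (i + j) = 0.
  move=> /(side_gain_opposite r0 r2) /(_ Gi) G; apply/eqP; rewrite eq_le G.
  by apply: Rintegral_ge0 => x _; rewrite le_max lexx.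
have nn j : 0 <= side_gain r a j by apply: Rintegral_ge0 => x _; rewrite le_max lexx.
rewrite (sum_cyclic6 i) ?side_gain_mod//; last exact: side_gain_mod.
have -> : \sum_(j < 6) side_gain r a (i + j) =
    side_gain r a i + side_gain r a (i + 1) + side_gain r a (i + 5).
  have f2 := far 2 isT; have f3 := far 3 isT; have f4 := far 4 isT.
  by rewrite !big_ord_recl big_ord0 /= /bump /= !addn0 f2 f3 f4; ring.
(* Here [a] straddles the vertex [i + 1]: side [i] is [(i + 1) + 5], the predecessor, and side
   [i + 5] is [(i + 1) + 4], not adjacent to side [i + 1]. *)
have [G1|] := ltP 0 (side_gain r a (i + 1)).
  have G5 : side_gain r a (i + 5) <= 0.
    by have := side_gain_opposite r0 r2 (_ : (1 < 4 < 5)%N) G1; rewrite -addnA; apply.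
  have -> : side_gain r a (i + 5) = 0 by apply/eqP; rewrite eq_le G5 nn.
  have E6 : side_gain r a (i + 1 + 5) = side_gain r a i.
    by rewrite -addnA -side_gain_mod modnDr side_gain_mod.
  have := side_gain_corner r0 G1; rewrite E6 => /(_ Gi)[M E].
  rewrite addr0 addrC; split => // /E h; exists (i + 1)%N; by left.
move=> G1; have -> : side_gain r a (i + 1) = 0 by apply/eqP; rewrite eq_le G1 nn.
rewrite addr0; have [G5|] := ltP 0 (side_gain r a (i + 5)).
  have [M E] := side_gain_corner r0 Gi G5.
  by split => // /E h; exists i; left.
move=> G5; have -> : side_gain r a (i + 5) = 0 by apply/eqP; rewrite eq_le G5 nn.
rewrite addr0; have [M E] := side_gain_single a i r0.
by split => // /E h; exists i; right.
Qed.

(** * The energy of a finite set *)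

(** Head and tail are separate arguments, so the minimum is over a nonempty list without a default
    value. *)
Definition near_sqdist (R : realType) (a0 : plane R) (s : seq (plane R))
    (x : plane R) : R :=
  foldr (fun a m => Num.min (sqdist x a) m) (sqdist x a0) s.

Lemma near_sqdist_le (R : realType) (a0 : plane R) s (x a : plane R) :
  a \in a0 :: s -> near_sqdist a0 s x <= sqdist x a.
Proof.
rewrite inE; elim: s => [|b s IH] /=; first by rewrite orbF => /eqP ->.
by rewrite ge_min inE orbCA => /predU1P[->|/IH ->]; rewrite ?lexx ?orbT.
Qed.

Lemma near_sqdist_attained (R : realType) (a0 : plane R) s (x : plane R) :
  exists2 a, a \in a0 :: s & near_sqdist a0 s x = sqdist x a.
Proof.
elim: s => [|b s [a ains E]] /=; first by exists a0; rewrite ?mem_head.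
rewrite E; case: leP => _; first by exists b; rewrite // !inE eqxx orbT.
exists a => //; move: ains; rewrite !inE => /orP[->//|->]; by rewrite !orbT.
Qed.

Lemma continuous_sqdist_side (R : realType) i (a : plane R) :
  continuous (fun t : R => sqdist (hex_side i t) a).
Proof.
set p := hex_frame i a.
have -> : (fun t : R => sqdist (hex_side i t) a) =
    (fun t => (p.1 ^+ 2 + p.2 ^+ 2) + (- 2 * p.1) * t - (-1) * t ^+ 2).
  by apply/funext => t; rewrite sqdist_side -/p; ring.
exact: continuous_quadratic.
Qed.

Lemma continuous_near_side (R : realType) i (a0 : plane R) s :
  continuous (fun t : R => near_sqdist a0 s (hex_side i t)).
Proof.
elim: s => [|b s IH] /=; first exact: continuous_sqdist_side.
move=> t; apply: (@continuous_min R R (fun t => sqdist (hex_side i t) b)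
  (fun t => near_sqdist a0 s (hex_side i t)) t); last exact: IH.
exact: continuous_sqdist_side.
Qed.

Lemma continuous_price (R : realType) (r : R) : continuous (price r).
Proof.
have lin al be : continuous (fun t : R => al + be * t).
  have := @continuous_quadratic R al be 0.
  by under eq_fun do rewrite mul0r subr0.
move=> t; set lam := 13 / 16 * r ^+ 2; set c := corner_slope R.
apply: (@continuous_min R R (cst lam) (fun t => Num.min (lam - c * r ^+ 2 + c * r * t)
  (lam - c * r ^+ 2 + c * r * (1 - t))) t); first exact: cvg_cst.
apply: (@continuous_min R R (fun t => lam - c * r ^+ 2 + c * r * t)
  (fun t => lam - c * r ^+ 2 + c * r * (1 - t)) t); first exact: lin.
have -> : (fun x : R => lam - c * r ^+ 2 + c * r * (1 - x)) =
    (fun x => (lam - c * r ^+ 2 + c * r) + (- (c * r)) * x).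
  by apply/funext => x; ring.
exact: lin.
Qed.

Lemma continuous_gain (R : realType) (r : R) i (a : plane R) :
  continuous (fun t : R => Num.max 0 (price r t - sqdist (hex_side i t) a)).
Proof.
move=> t; apply: (@continuous_max R R (cst 0)
  (fun t => price r t - sqdist (hex_side i t) a) t); first exact: cvg_cst.
by apply: cvgB; [exact: continuous_price | exact: continuous_sqdist_side].
Qed.

Lemma continuous_sum_seq (R : realType) (T : Type) (s : seq T) (F : T -> R -> R) :
  (forall a, continuous (F a)) -> continuous (fun t => \sum_(a <- s) F a t).
Proof.
move=> cF; elim: s => [|a s IH].
  by under eq_fun do rewrite big_nil; move=> t; exact: cvg_cst.
under eq_fun do rewrite big_cons.
by move=> t; apply: cvgD; [exact: cF|exact: IH].
Qed.

Lemma Rintegral_sum_seq (R : realType) (T : Type) (s : seq T) (F : T -> R -> R) (a b : R) :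
  (forall u, continuous (F u)) ->
  \int[@lebesgue_measure R]_(t in `[a, b]) (\sum_(u <- s) F u t) =
  \sum_(u <- s) \int[@lebesgue_measure R]_(t in `[a, b]) F u t.
Proof.
move=> cF; elim: s => [|u s IH].
  under eq_Rintegral do rewrite big_nil.
  by rewrite big_nil (Rintegral_cst (@lebesgue_measure R))// mul0r.
under eq_Rintegral do rewrite big_cons.
rewrite big_cons RintegralD ?IH//; first exact: continuous_integrable_itv.
by apply: continuous_integrable_itv; exact: continuous_sum_seq.
Qed.

(** The pointwise slack of the dual inequality. *)
Definition excess (R : realType) (r : R) (a0 : plane R) s i (t : R) : R :=
  near_sqdist a0 s (hex_side i t) - price r t +
  \sum_(a <- a0 :: s) Num.max 0 (price r t - sqdist (hex_side i t) a).

Lemma continuous_excess (R : realType) (r : R) (a0 : plane R) s i :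
  continuous (excess r a0 s i).
Proof.
move=> t; apply: cvgD.
  by apply: cvgB; [exact: continuous_near_side | exact: continuous_price].
by apply: continuous_sum_seq => a; exact: continuous_gain.
Qed.

(** The gain of the nearest point alone makes up for the difference. *)
Lemma excess_ge0 (R : realType) (r : R) (a0 : plane R) s i (t : R) :
  0 <= excess r a0 s i t.
Proof.
rewrite /excess; have [a ains ->] := near_sqdist_attained a0 s (hex_side i t).
rewrite (perm_big _ (perm_to_rem ains)) big_cons /=.
set S := \sum_(_ <- _) _.
have : 0 <= S by apply: sumr_ge0 => b _; rewrite le_max lexx.
have : price r t - sqdist (hex_side i t) a <= Num.max 0 (price r t - sqdist (hex_side i t) a).
  by rewrite le_max lexx orbT.
lra.
Qed.

(** Without slack the nearest point collects the whole difference and all other gains vanish: the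
    discs cover, and their interiors do not overlap. *)
Lemma excess_eq0 (R : realType) (r : R) (a0 : plane R) s i (t : R) :
  excess r a0 s i t = 0 ->
  (exists2 a, a \in a0 :: s & sqdist (hex_side i t) a <= price r t) /\
  (forall a b, a \in a0 :: s -> b \in a0 :: s ->
     sqdist (hex_side i t) a < price r t -> sqdist (hex_side i t) b < price r t ->
     a = b).
Proof.
rewrite /excess; have [c cins cE] := near_sqdist_attained a0 s (hex_side i t).
rewrite cE (perm_big _ (perm_to_rem cins)) big_cons /=.
set w := fun a => Num.max 0 (price r t - sqdist (hex_side i t) a).
rewrite -/(w c); set S := \sum_(_ <- _) _ => E0.
have w0 a : 0 <= w a by rewrite le_max lexx.
have wc : price r t - sqdist (hex_side i t) c <= w c by rewrite le_max lexx orbT.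
have S0 : 0 <= S by apply: sumr_ge0 => b _; exact: w0.
have E1 : w c + S = price r t - sqdist (hex_side i t) c by lra.
split; first by exists c => //; have := w0 c; lra.
have only a : a \in a0 :: s -> sqdist (hex_side i t) a < price r t -> a = c.
  move=> ains lt_a; apply/eqP/negPn/negP => ac.
  have arem : a \in rem c (a0 :: s).
    by move: ains; rewrite (perm_mem (perm_to_rem cins)) inE (negPf ac).
  have : w a <= S.
    rewrite /S (perm_big _ (perm_to_rem arem)) big_cons lerDl.
    by apply: sumr_ge0 => b _; exact: w0.
  have : price r t - sqdist (hex_side i t) a <= w a by rewrite le_max lexx orbT.
  lra.
by move=> a b /only ha /only hb /ha -> /hb ->.
Qed.

Lemma Rintegral_price (R : realType) (r : R) : 0 < r -> r <= 1 / 2 ->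
  \int[@lebesgue_measure R]_(t in `[0, 1]) price r t =
  13 / 16 * r ^+ 2 - corner_slope R * r ^+ 3.
Proof.
move=> r0 r2; have /andP[c1 _] := corner_slope_bounds R.
rewrite /price; set c := corner_slope R in c1 *; set lam := 13 / 16 * r ^+ 2.
have cr0 : 0 < c * r by rewrite mulr_gt0//; lra.
have cp := continuous_price (r := r).
rewrite (Rintegral_itv_cat cp (ltW r0)); last by lra.
rewrite (Rintegral_itv_cat cp (_ : r <= 1 - r)); [|by lra|by lra].
have quad al be s t : s <= t -> (forall x, s <= x <= t -> price r x = al + be * x) ->
    \int[@lebesgue_measure R]_(x in `[s, t]) price r x =
    al * (t - s) + be * (t ^+ 2 - s ^+ 2) / 2.
  move=> st prE; have := Rintegral_quadratic al be 0 st.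
  rewrite !mul0r subr0 => <-; apply: eq_Rintegral => x.
  by rewrite inE /= in_itv/= => /prE ->; rewrite mul0r subr0.
rewrite (quad (lam - c * r ^+ 2) (c * r)) ?(ltW r0)//; last first.
  move=> x /andP[x0 xr]; rewrite /price -/c -/lam.
  by rewrite (@min_l _ _ (_ + c * r * x)) ?min_r//; nra.
rewrite (quad lam 0); [|lra|]; last first.
  move=> x /andP[x0 xr]; rewrite /price -/c -/lam mul0r addr0.
  by rewrite min_l// le_min; apply/andP; split; nra.
rewrite (quad (lam - c * r ^+ 2 + c * r) (- (c * r))); [|lra|]; last first.
  move=> x /andP[x0 xr]; rewrite /price -/c -/lam.
  by rewrite (@min_r _ _ (_ + c * r * x)) ?min_r; [ring|nra|nra].
by field.
Qed.

Definition energy (R : realType) (a0 : plane R) s : R :=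
  \sum_(i < 6) \int[@lebesgue_measure R]_(t in `[0, 1]) near_sqdist a0 s (hex_side i t).

Lemma energy_excess (R : realType) (r : R) (a0 : plane R) s : 0 < r -> r <= 1 / 2 ->
  energy a0 s =
  \sum_(i < 6) \int[@lebesgue_measure R]_(t in `[0, 1]) excess r a0 s i t +
  6 * (13 / 16 * r ^+ 2 - corner_slope R * r ^+ 3) -
  \sum_(a <- a0 :: s) \sum_(i < 6) side_gain r a i.
Proof.
move=> r0 r2; rewrite exchange_big /=.
have -> : 6 * (13 / 16 * r ^+ 2 - corner_slope R * r ^+ 3) =
    \sum_(i < 6) \int[@lebesgue_measure R]_(t in `[0, 1]) price r t.
  by rewrite sumr_const card_ord Rintegral_price// mulr_natl.
rewrite -big_split /= -sumrB; apply: eq_bigr => i _.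
rewrite /excess RintegralD//; first last.
- by apply: continuous_integrable_itv; apply: continuous_sum_seq => a; exact: continuous_gain.
- apply: continuous_integrable_itv => t.
  by apply: cvgB; [exact: continuous_near_side | exact: continuous_price].
rewrite RintegralB//; first last.
- by apply: continuous_integrable_itv; exact: continuous_price.
- by apply: continuous_integrable_itv; exact: continuous_near_side.
rewrite Rintegral_sum_seq; last by move=> a; exact: continuous_gain.
by rewrite /side_gain; ring.
Qed.

(** The hypothesis reads [2 r + 2 rho m = 1]: a side consists of two corner pieces and [m] pieces of
    length [2 rho]. *)
Lemma optimum_value (R : realType) (r : R) (m : nat) :
  r * (Num.sqrt 13 * m%:R / 2 + 2) = 1 ->
  6 * (13 / 16 * r ^+ 2 - corner_slope R * r ^+ 3) - (6 * m.+1)%:R * max_gain r =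
  13 / 8 * r ^+ 2.
Proof.
have -> : (6 * m.+1)%:R = 6 * (m%:R + 1) :> R by rewrite natr1 natrM.
rewrite /corner_slope /max_gain; set w : R := Num.sqrt 13 => rm.
have wm : r * w * m%:R = 2 - 4 * r by lra.
transitivity (39 / 8 * r ^+ 2 - 13 / 2 * r ^+ 3 - 13 / 8 * r ^+ 2 * (r * w * m%:R)); first by field.
by rewrite wm; field.
Qed.

(** The energy exceeds the bound by a sum of nonnegative terms: the integrated excess, what each
    point gains less than the maximum, and one maximal gain per missing point. Equality cancels them
    all, and continuity turns a zero integral of the excess into its vanishing everywhere. *)
Lemma energy_bound (R : realType) (r : R) (m : nat) (a0 : plane R) s :
  0 < r -> r <= 1 / 2 -> r * (Num.sqrt 13 * m%:R / 2 + 2) = 1 ->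
  (size (a0 :: s) <= 6 * m.+1)%N ->
  13 / 8 * r ^+ 2 <= energy a0 s /\
  (energy a0 s = 13 / 8 * r ^+ 2 ->
   (forall i t, 0 <= t <= 1 -> excess r a0 s i t = 0) /\
   (forall a, a \in a0 :: s -> \sum_(i < 6) side_gain r a i = max_gain r)).
Proof.
move=> r0 r2 rm sz; rewrite -(optimum_value rm) (energy_excess _ _ r0 r2).
set K := 6 * _; set X := \sum_(i < 6) _; set C := max_gain r.
have C0 : 0 < C.
  by rewrite /C /max_gain !(mulr_gt0, divr_gt0, exprn_gt0)// ?sqrt13_gt0.
have Xi i : 0 <= \int[@lebesgue_measure R]_(t in `[0, 1]) excess r a0 s i t.
  by apply: Rintegral_ge0 => t _; exact: excess_ge0.
have X0 : 0 <= X by apply: sumr_ge0 => i _.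
have defect : 0 <= \sum_(a <- a0 :: s) (C - \sum_(i < 6) side_gain r a i).
  by apply: sumr_ge0 => a _; rewrite subr_ge0; have [] := total_gain_bound a r0 r2.
have sumC : \sum_(a <- a0 :: s) C = (size (a0 :: s))%:R * C.
  by rewrite big_const_seq count_predT iter_addr_0 mulr_natl.
have szC : (size (a0 :: s))%:R * C <= (6 * m.+1)%:R * C by rewrite ler_pM2r// ler_nat.
have defE := defect; rewrite sumrB sumC in defE.
split; first lra.
move=> E.
have XE : X = 0 by lra.
have dE : \sum_(a <- a0 :: s) (C - \sum_(i < 6) side_gain r a i) = 0.
  by rewrite sumrB sumC; lra.
split.
  move=> i t t01.
  have IE : \int[@lebesgue_measure R]_(t in `[0, 1]) excess r a0 s (i %% 6) t = 0.
    have /psumr_eq0P /(_ XE) H : forall j : 'I_6, true ->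
       0 <= \int[@lebesgue_measure R]_(t in `[0, 1]) excess r a0 s j t by move=> j _.
    exact: (H (Ordinal (ltn_pmod i (isT : 0 < 6)%N))).
  have -> : excess r a0 s i t = excess r a0 s (i %% 6) t.
    by rewrite /excess hex_side_mod.
  exact: (Rintegral_eq0_continuous ltr01 (@continuous_excess R r a0 s (i %% 6))
    (fun t _ => excess_ge0 r a0 s _ t) IE t01).
move=> a ains; apply/eqP; rewrite eq_sym -subr_eq0; apply/eqP.
have d0 b : 0 <= C - \sum_(i < 6) side_gain r b i.
  by rewrite subr_ge0; have [] := total_gain_bound b r0 r2.
move: dE; rewrite (perm_big _ (perm_to_rem ains)) big_cons /= => /eqP.
by rewrite paddr_eq0 ?sumr_ge0// => /andP[/eqP ->].
Qed.

(** * Distortion as an energy *)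

Lemma enorm_sqdist (R : realType) (x a : plane R) : enorm (x - a) ^+ 2 = sqdist x a.
Proof. by rewrite /enorm sqr_sqrtr// addr_ge0 ?sqr_ge0. Qed.

Lemma ereal_inf_near_sqdist (R : realType) (a0 : plane R) s (x : plane R) :
  ereal_inf [set (enorm (x - a) ^+ 2)%:E | a in [set` a0 :: s]] =
  (near_sqdist a0 s x)%:E.
Proof.
apply/eqP; rewrite eq_le; apply/andP; split.
  have [a ains ->] := near_sqdist_attained a0 s x.
  by apply: ereal_inf_lbound; exists a => //; rewrite enorm_sqdist.
apply: le_ereal_inf_tmp => _ [a /= ains <-].
by rewrite lee_fin enorm_sqdist near_sqdist_le.
Qed.

Lemma measurable_near_sqdist (R : realType) (a0 : plane R) s :
  measurable_fun [set: plane R] (near_sqdist a0 s).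
Proof.
have ms a : measurable_fun [set: plane R] (fun x => sqdist x a).
  apply: measurable_funD; apply: measurable_funX; apply: measurable_funB => //.
elim: s => [|b s IH] /=; first exact: ms.
by apply: measurable_minr; [exact: ms|exact: IH].
Qed.

Lemma ge0_integral_mrestr d (X : measurableType d) (R : realType)
    (mu : {measure set X -> \bar R}) (D : set X) (mD : measurable D)
    (f : X -> \bar R) : measurable_fun [set: X] f -> (forall x, 0 <= f x)%E ->
  (\int[mrestr mu mD]_x f x = \int[mu]_(x in D) f x)%E.
Proof.
move=> mf f0; rewrite -(setUv D) ge0_integral_setU//; first last.
- by apply/disj_setPS => x [].

- by rewrite setUv.
- exact: measurableC.
rewrite (eq_measure_integral mu); last first.
  by move=> A mA AD; rewrite -[LHS]/(mu (A `&` D)) setIidl.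
rewrite (@eq_measure_integral _ _ _ (~` D) mzero); last first.
  by move=> A mA AD; rewrite -[LHS]/(mu (A `&` D)) (disjoints_subset _ _).2 ?measure0.
by rewrite integral_measure_zero adde0.
Qed.

Lemma integral_arc_length (R : realType) i (f : plane R -> \bar R) :
  measurable_fun [set: plane R] f -> (forall x, 0 <= f x)%E -> (i < 6)%N ->
  (\int[arc_length (hexv R i) (hexv R i.+1)]_x f x =
   \int[@lebesgue_measure R]_(t in `[0%R, 1%R]) f (hex_side i t))%E.
Proof.
move=> mf f0 i6; rewrite ge0_integral_pushforward//=; last first.
  exact: measurable_seg_param.
rewrite preimage_setT ge0_integral_mscale//=; last first.
  exact: (measurableT_comp mf (measurable_seg_param _ _)).
rewrite enorm_hexedge// mul1e ge0_integral_mrestr//.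
exact: (measurableT_comp mf (measurable_seg_param _ _)).
Qed.

Lemma distortion_energy (R : realType) (a0 : plane R) s :
  distortion (hexagon_uniform R) [set` a0 :: s] = (energy a0 s / 6)%:E.
Proof.
rewrite /distortion.
under eq_integral do rewrite ereal_inf_near_sqdist.
have mf : measurable_fun [set: plane R] (fun x => (near_sqdist a0 s x)%:E).
  by apply/measurable_EFinP; exact: measurable_near_sqdist.
have f0 x : (0 <= (near_sqdist a0 s x)%:E)%E.
  rewrite lee_fin; have [a _ ->] := near_sqdist_attained a0 s x.
  exact: sqdist_ge0.
rewrite ge0_integral_mscale//= ge0_integral_measure_sum//.
rewrite mulrC EFinM /energy -sumEFin; congr (_ * _)%E.
apply: eq_bigr => i _; rewrite integral_arc_length//.
rewrite /Rintegral fineK//; apply: integrable_fin_num => //.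
exact: (continuous_integrable_itv 0 1 (@continuous_near_side R i a0 s)).
Qed.

Lemma distortion_set0 (R : realType) (P : probability (plane R) R) :
  distortion P set0 = +oo%E.
Proof.
rewrite /distortion; under eq_integral do rewrite image_set0 ereal_inf0.
by rewrite integral_cst//= probability_setT mule1.
Qed.

Lemma card_le_seq (T : choiceType) (A : set T) n : A #<= `I_n ->
  exists s : seq T, A = [set` s] /\ (size s <= n)%N.
Proof.
move=> An; have fA : finite_set A by apply/finite_set_leP; exists n.
exists (finmap.enum_fset (fset_set A)); split; last exact: geq_card_fset_set.
by apply/seteqP; split => x /=; rewrite in_fset_set// inE.
Qed.

(** The list may have repetitions, so the indices are mapped onto it by [nth]. *)
Lemma seq_card_le (T : choiceType) (s : seq T) n : (size s <= n)%N ->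
  [set` s] #<= `I_n.
Proof.
case: s => [|x0 s] sn; first by rewrite (_ : [set` [::]] = set0) ?card_ge0// -subset0.
apply: card_le_trans (_ : _ #<= `I_(size (x0 :: s))) _; last by rewrite card_le_II.
rewrite (_ : [set` x0 :: s] = nth x0 (x0 :: s) @` `I_(size (x0 :: s))) ?card_image_le//.
apply/seteqP; split => [x xs|_ [i /= i_s <-]]; last exact: mem_nth.
by exists (index x (x0 :: s)); [exact: (etrans (index_mem x (x0 :: s)) xs)|rewrite nth_index].
Qed.

(** * Prices and reach of the two kinds of extremal points *)

Definition rho (R : realType) (r : R) : R := Num.sqrt 13 / 4 * r.

Lemma rho_sqr (R : realType) (r : R) : rho r ^+ 2 = 13 / 16 * r ^+ 2.
Proof. by rewrite /rho exprMn expr_div_n sqrt13_sqr; field. Qed.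

Lemma rho_bounds (R : realType) (r : R) : 0 < r -> 9 / 10 * r < rho r < 29 / 32 * r.
Proof. by move=> r0; have [? ?] := sqrt13_bounds R; rewrite /rho; apply/andP; split; nra. Qed.

Lemma price_le (R : realType) (r t : R) : price r t <= 13 / 16 * r ^+ 2.
Proof. by rewrite /price ge_min lexx. Qed.

Lemma price0_lt (R : realType) (r : R) : 0 < r -> price r 0 < 13 / 16 * r ^+ 2.
Proof.
move=> r0; have /andP[c1 _] := corner_slope_bounds R.
apply: (@le_lt_trans _ _ (13 / 16 * r ^+ 2 - corner_slope R * r ^+ 2)).
  by rewrite /price mulr0 addr0 !ge_min lexx orbT.
by rewrite ltrBlDr ltrDl mulr_gt0 ?exprn_gt0//; lra.
Qed.

Lemma price_mid (R : realType) (r t : R) : 0 < r -> r <= t -> t <= 1 - r ->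
  price r t = 13 / 16 * r ^+ 2.
Proof.
move=> r0 rt tr; have /andP[c1 _] := corner_slope_bounds R.
have cr0 : 0 < corner_slope R * r by rewrite mulr_gt0//; lra.
by rewrite /price min_l// le_min; apply/andP; split; nra.
Qed.

Lemma price_start (R : realType) (r t : R) : 0 < r -> r <= 1 / 2 -> 0 <= t -> t <= r ->
  price r t = 13 / 16 * r ^+ 2 - corner_slope R * r * (r - t).
Proof.
move=> r0 r2 t0 tr; have /andP[c1 _] := corner_slope_bounds R.
have cr0 : 0 < corner_slope R * r by rewrite mulr_gt0//; lra.
rewrite /price (@min_l _ _ (_ + corner_slope R * r * t)) ?min_r; [ring|nra|nra].
Qed.

Lemma hex_frame_own_side (R : realType) i (t : R) : hex_frame i (hex_side i t) = (t, 0).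
Proof. by have := hex_frame_side i 0 t; rewrite addn0 => ->; rewrite hex_side_coord. Qed.

Lemma mod6_diff (i k : nat) : exists2 j, (j < 6)%N & ((k + j) %% 6 = i %% 6)%N.
Proof. by exists ((i + 5 * k) %% 6)%N; [rewrite ltn_mod | lia]. Qed.

(** The margin [t^2 (1 - t)^2] vanishes only at the ends: the disc of a side point may touch a
    vertex, but stays strictly away from the interior of the other sides. *)
Lemma side_point_far (R : realType) (r p t : R) j : 0 < r -> r <= 1 / 2 ->
  rho r <= p -> p <= 1 - rho r -> 0 <= t <= 1 -> (0 < j < 6)%N ->
  13 / 16 * r ^+ 2 + t ^+ 2 * (1 - t) ^+ 2 <= sqdist (hex_side j t) (p, 0).
Proof.
move=> r0 r2 p1 p2 /andP[t0 t1] /andP[j0 j6]; rewrite hex_side_coord// -rho_sqr.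
have /andP[rh1 rh2] := rho_bounds r0; have := sqrt3_sqr R.
have rho2 : rho r ^+ 2 <= 1 / 4.
  have : r ^+ 2 <= 1 / 4 by nra.
  by rewrite rho_sqr; lra.
have rho0 : 0 <= rho r by lra.
have tt1 : t ^+ 2 * (1 - t) ^+ 2 <= t ^+ 2.
  have : (1 - t) ^+ 2 <= 1 by nra.
  by move=> ?; rewrite ler_piMr ?sqr_ge0.
have tt2 : t ^+ 2 * (1 - t) ^+ 2 <= (1 - t) ^+ 2.
  have : t ^+ 2 <= 1 by nra.
  by move=> ?; rewrite ler_piMl ?sqr_ge0.
have tt3 : t ^+ 2 * (1 - t) ^+ 2 <= 1 / 4.
  by have [?|?] := leP t (1 / 2); nra.
case: j j0 j6 => [|[|[|[|[|[|//]]]]]] // _ _; rewrite /sqdist /=;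
  set z := Num.sqrt 3 => z2.
- have : rho r ^+ 2 <= (1 - p) ^+ 2 by rewrite ler_pXn2r ?nnegrE//; lra.
  have : 0 <= t * (1 - p) by rewrite mulr_ge0//; lra.
  nra.
- nra.
- nra.
- nra.
- have : rho r ^+ 2 <= p ^+ 2 by rewrite ler_pXn2r ?nnegrE//; lra.
  have : 0 <= p * (1 - t) by rewrite mulr_ge0//; lra.
  nra.
Qed.

Lemma sqdist_corner (R : realType) (r t : R) j : (j < 6)%N ->
  sqdist (hex_side j t) (r / 8, Num.sqrt 3 * r / 8) =
  nth 0 [:: (t - r / 8) ^+ 2 + 3 * (r / 8) ^+ 2;
    (1 + t / 2 - r / 8) ^+ 2 + 3 * (t / 2 - r / 8) ^+ 2;
    (3 / 2 - t / 2 - r / 8) ^+ 2 + 3 * (1 / 2 + t / 2 - r / 8) ^+ 2;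
    (1 - t - r / 8) ^+ 2 + 3 * (1 - r / 8) ^+ 2;
    (t / 2 + r / 8) ^+ 2 + 3 * (1 - t / 2 - r / 8) ^+ 2;
    ((1 - t) / 2 + r / 8) ^+ 2 + 3 * ((1 - t) / 2 - r / 8) ^+ 2] j.
Proof.
move=> j6; rewrite hex_side_coord// /sqdist.
have z2 := sqrt3_sqr R; move: z2; set z := Num.sqrt 3 => z2.
case: j j6 => [|[|[|[|[|[|//]]]]]] _ /=;
  match goal with |- _ = _ + _ * ?y ^+ 2 =>
    have <- : z ^+ 2 * y ^+ 2 = 3 * y ^+ 2 by rewrite z2 end; by field.
Qed.

Lemma corner_far_vertex (R : realType) (r : R) j : 0 < r -> r <= 1 / 2 ->
  (0 < j < 6)%N ->
  13 / 16 * r ^+ 2 < sqdist (hex_side j 0) (r / 8, Num.sqrt 3 * r / 8).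
Proof.
move=> r0 r2 /andP[j0 j6]; rewrite sqdist_corner//.
have rr : r ^+ 2 <= 1 / 4 by nra.
by case: j j0 j6 => [|[|[|[|[|[|//]]]]]] // _ _ /=; nra.
Qed.

(** The strict bounds on [t] matter: on its own two sides the corner point is at squared distance
    exactly [13 / 16 * r^2] from the points at distance [r] from the vertex. *)
Lemma corner_far_mid (R : realType) (r t : R) j : 0 < r -> r <= 1 / 2 ->
  r < t -> t < 1 - r -> (j < 6)%N ->
  13 / 16 * r ^+ 2 < sqdist (hex_side j t) (r / 8, Num.sqrt 3 * r / 8).
Proof.
move=> r0 r2 rt tr j6; rewrite sqdist_corner//.
have rr : r ^+ 2 <= 1 / 4 by nra.
by case: j j6 => [|[|[|[|[|[|//]]]]]] // _ /=; nra.
Qed.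

(** * Tight configurations *)

(** The complementary slackness conditions, from which the whole configuration is recovered. *)
Definition tight (R : realType) (r : R) (s : seq (plane R)) : Prop :=
  [/\ forall i t, 0 <= t <= 1 ->
        exists2 a, a \in s & sqdist (hex_side i t) a <= price r t,
      forall i t, 0 <= t <= 1 -> forall a b, a \in s -> b \in s ->
        sqdist (hex_side i t) a < price r t ->
        sqdist (hex_side i t) b < price r t -> a = b
    & forall a, a \in s -> exists i,
        hex_frame i a = (r / 8, Num.sqrt 3 * r / 8) \/
        exists p, [/\ rho r <= p, p <= 1 - rho r & hex_frame i a = (p, 0)]].

(** At a vertex the price is strictly below [rho^2], so neither a side point nor the centroid at
    another vertex can cover it. *)
Lemma tight_corner (R : realType) (r : R) s i : 0 < r -> r <= 1 / 2 -> tight r s ->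
  exists2 a, a \in s & hex_frame i a = (r / 8, Num.sqrt 3 * r / 8).
Proof.
move=> r0 r2 [cov _ typ].
have [a ains] := cov i 0 (introT andP (conj (lexx _) ler01)).
move=> /le_lt_trans /(_ (price0_lt r0)) qa.
have [k ka] := typ a ains; have [j j6 kj] := mod6_diff i k.
move: qa; rewrite -hex_side_mod -kj hex_side_mod -(sqdist_frame k) hex_frame_side.
case: ka => [ka|[p [p1 p2 ka]]]; rewrite ka.
  have [j0|j0] := posnP j.
    by move=> _; exists a => //; rewrite -hex_frame_mod -kj j0 addn0 hex_frame_mod.
  have := @corner_far_vertex R r j r0 r2; rewrite j0 j6 => /(_ isT) /lt_trans h.
  by move=> /h; rewrite ltxx.
have [j0|j0] := posnP j.
  rewrite j0 hex_side_coord//= /sqdist/= subrr expr0n addr0 sub0r sqrrN -rho_sqr.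
  have /andP[rh _] := rho_bounds r0.
  by rewrite ltNge ler_pXn2r ?nnegrE ?p1//; lra.
have := @side_point_far R r p 0 j r0 r2 p1 p2; rewrite lexx ler01 j0 j6 => /(_ isT isT).
by rewrite expr0n mul0r addr0 leNgt => /negbTE ->.
Qed.

Lemma tight_cover (R : realType) (r t : R) s i : 0 < r -> r <= 1 / 2 -> tight r s ->
  r < t -> t < 1 - r ->
  exists p, [/\ rho r <= p, p <= 1 - rho r, hex_side i p \in s,
    p - rho r <= t & t <= p + rho r].
Proof.
move=> r0 r2 [cov _ typ] rt tr.
have t01 : 0 <= t <= 1 by apply/andP; split; lra.
have [a ains] := cov i t t01.
move=> /le_trans /(_ (price_le r t)) qa.
have [k ka] := typ a ains; have [j j6 kj] := mod6_diff i k.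
move: qa; rewrite -hex_side_mod -kj hex_side_mod -(sqdist_frame k) hex_frame_side.
case: ka => [ka|[p [p1 p2 ka]]]; rewrite ka.
  by rewrite leNgt corner_far_mid.
have [j0|j0] := posnP j.
  have aE : a = hex_side i p.
    apply: (@hex_frame_inj _ k).
    by rewrite ka -(hex_side_mod i) -kj j0 addn0 hex_side_mod hex_frame_own_side.
  rewrite j0 hex_side_coord//= /sqdist/= subrr expr0n addr0 -rho_sqr.
  have /andP[rh _] := rho_bounds r0.
  move=> q; exists p; split; rewrite -?aE//; nra.
have := side_point_far r0 r2 p1 p2 t01 (introT andP (conj j0 j6)).
have : 0 < t ^+ 2 * (1 - t) ^+ 2 by rewrite mulr_gt0// exprn_gt0//; lra.
lra.
Qed.

(** A side point closer to the vertex would share a stretch just before [r] with the corner point,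
    and the two are distinct since the latter lies off the side. *)
Lemma tight_side_start (R : realType) (r p : R) s i : 0 < r -> r <= 1 / 2 -> tight r s ->
  rho r <= p -> p <= 1 - rho r -> hex_side i p \in s -> r + rho r <= p.
Proof.
move=> r0 r2 ts p1 p2 ps; rewrite leNgt; apply/negP => pr.
have [a ains aE] := tight_corner i r0 r2 ts; have [_ dis _] := ts.
(* One quarter of the overlap before [r]. As [p >= rho], the overlap is at most [r], so [x] stays
   near [r] and the price cut, at most [r / 9] times [r - x], is too small to exclude either
   point. *)
pose x := r - (r + rho r - p) / 4.
have /andP[rh1 rh2] := rho_bounds r0.
have /andP[c1 c2] := corner_slope_bounds R.
have x0 : 0 <= x by rewrite /x; lra.
have xr : x < r by rewrite /x; lra.
have x01 : 0 <= x <= 1 by apply/andP; split; lra.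
set c := corner_slope R in c1 c2.
have cr : 0 < c * r by rewrite mulr_gt0//; lra.
have apE : a = hex_side i p.
  apply: (dis i x x01 _ _ ains ps); rewrite (price_start r0 r2 x0 (ltW xr)) -/c.
    rewrite sqdist_side aE /=.
    have -> : (Num.sqrt 3 * r / 8) ^+ 2 = 3 * (r / 8) ^+ 2.
      by rewrite !exprMn sqrt3_sqr; field.
    have cr9 : c * r <= r / 9 by nra.
    have : 0 < (r - x) * (x + 3 / 4 * r - c * r) by rewrite mulr_gt0 ?subr_gt0//; lra.
    lra.
  rewrite sqdist_side hex_frame_own_side /= expr0n addr0 -rho_sqr.
  pose e := r - x.
  have pE : p = r + rho r - 4 * e by rewrite /e /x; field.
  have e0 : 0 < e by rewrite subr_gt0.
  have -> : x - p = - (rho r - 3 * e) by rewrite pE /e; ring.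
  rewrite -/e sqrrN.
  have h : c * r <= r / 9 by nra.
  have h1 : c * r * e <= r / 9 * e by rewrite ler_pM2r.
  have h2 : 4 * e <= r by lra.
  have h3 : 0 <= e * (r - 4 * e) by rewrite mulr_ge0 ?subr_ge0// ltW.
  have h4 : 0 < e * (rho r - 9 / 10 * r) by rewrite mulr_gt0// subr_gt0.
  have h5 : 0 < e * r by rewrite mulr_gt0.
  lra.
have : hex_frame i a = (p, 0) by rewrite apE hex_frame_own_side.
rewrite aE => -[_] /eqP; rewrite gt_eqF// divr_gt0// mulr_gt0// sqrtr_gt0//.
Qed.

Lemma tight_side_separated (R : realType) (r p p' : R) s i : 0 < r -> r <= 1 / 2 ->
  tight r s -> rho r <= p -> p < p' -> p' <= 1 - rho r ->
  hex_side i p \in s -> hex_side i p' \in s -> p + 2 * rho r <= p'.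
Proof.
move=> r0 r2 ts p1 pp' p2 ps p's; rewrite leNgt; apply/negP => near.
have rp := tight_side_start r0 r2 ts p1 (ltW (lt_le_trans pp' p2)) ps.
have /andP[rh1 rh2] := rho_bounds r0; have [_ dis _] := ts.
have [x [x1 x2 [x3 x4 x5 x6]]] : exists x, [/\ r <= x, x <= 1 - r &
    [/\ x - p < rho r, p - x < rho r, p' - x < rho r & x - p' < rho r]].
  (* The midpoint is the natural common point of the two discs; past [1 - r], where the price is
     lower, [1 - r] itself replaces it. *)
  have [h|h] := leP ((p + p') / 2) (1 - r).
    by exists ((p + p') / 2); do ![split]; lra.
  by exists (1 - r); do ![split]; lra.
have x01 : 0 <= x <= 1 by apply/andP; split; lra.
have : hex_side i p = hex_side i p'.
  by apply: (dis i x x01 _ _ ps p's); rewrite (price_mid r0 x1 x2) -rho_sqr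
    sqdist_side hex_frame_own_side /= expr0n addr0; nra.
move=> /(congr1 (@hex_frame R i)); rewrite !hex_frame_own_side => -[E].
by move: pp'; rewrite E ltxx.
Qed.

(** Midpoints of consecutive intervals of length [2 rho] starting at [r], numbered from 1. *)
Definition side_center (R : realType) (r : R) (j : nat) : R :=
  r + (2 * j%:R - 1) * rho r.

(** Left to right induction: the first [j] points are known and all others lie at or beyond the next
    center, so whichever point covers that center must be there exactly. *)
Lemma tight_side_centers (R : realType) (r : R) m s i : 0 < r -> r <= 1 / 2 ->
  1 - 2 * r = 2 * rho r * m%:R -> tight r s -> forall j, (j <= m)%N ->
  (forall l, (1 <= l <= j)%N -> hex_side i (side_center r l) \in s) /\
  (forall p, rho r <= p -> p <= 1 - rho r -> hex_side i p \in s ->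
     side_center r j.+1 <= p \/ exists2 l, (1 <= l <= j)%N & p = side_center r l).
Proof.
move=> r0 r2 rm ts; have /andP[rh1 rh2] := rho_bounds r0.
have cS j : side_center r j.+1 = side_center r j + 2 * rho r.
  by rewrite /side_center -natr1; ring.
have c_le l j : (l <= j)%N -> side_center r l <= side_center r j.
  move=> lj; rewrite lerD2l ler_pM2r; last lra.
  by rewrite lerD2r ler_pM2l// ler_nat.
elim=> [_|j IH jm].
  split => [l|p p1 p2 ps]; first by case: l.
  left; have := tight_side_start r0 r2 ts p1 p2 ps.
  by rewrite /side_center; lra.
have [IH1 IH2] := IH (ltnW jm).
set c := side_center r j.+1.
have c1 : r + rho r <= c.
  by have := c_le 1%N j.+1 isT; rewrite -/c /side_center; lra.
have c2 : c <= 1 - r - rho r.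
  have := c_le j.+1 m jm; rewrite -/c [side_center r m]/side_center; lra.
have prev l : (1 <= l <= j)%N -> side_center r l <= c - 2 * rho r.
  by move=> /andP[_ /c_le]; rewrite /c cS; lra.
have rh0 : 0 < rho r by lra.
have [p [p1 p2 ps pc1 pc2]] : exists p, [/\ rho r <= p, p <= 1 - rho r, hex_side i p \in s,
    p - rho r <= c & c <= p + rho r].
  by apply: tight_cover => //; lra.
have cp : c <= p.
  by have [//|[l lj pE]] := IH2 p p1 p2 ps; have := prev l lj; lra.
have pE : p = c.
  apply/eqP; rewrite eq_le cp andbT leNgt; apply/negP => ltcp.
  (* If [p] were beyond [c], the place [(c + p) / 2 - rho] would lie outside its disc; the point [q]
     covering it satisfies [c <= q < p <= c + rho], too close to [p]. *)
  have [q [q1 q2 qs qc1 qc2]] : exists q, [/\ rho r <= q, q <= 1 - rho r,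
      hex_side i q \in s, q - rho r <= (c + p) / 2 - rho r & (c + p) / 2 - rho r <= q + rho r].
    by apply: tight_cover => //; lra.
  have cq : c <= q.
    by have [//|[l lj qE]] := IH2 q q1 q2 qs; have := prev l lj; lra.
  have qp : q < p by lra.
  by have := tight_side_separated r0 r2 ts q1 qp p2 qs ps; lra.
split.
  move=> l /andP[l1]; rewrite leq_eqVlt => /predU1P[->|lj].
    by rewrite -/c -pE.
  by apply: IH1; rewrite l1 -ltnS.
move=> q q1 q2 qs; have [cq|[l /andP[l1 lj] ->]] := IH2 q q1 q2 qs; last first.
  by right; exists l => //; rewrite l1 (leq_trans lj).
have [qc|qc] := eqVneq q c; first by right; exists j.+1; rewrite ?leqnn.
left; rewrite cS -/c -pE.
apply: (tight_side_separated r0 r2 ts p1 _ q2 ps qs).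
by rewrite pE lt_neqAle eq_sym qc.
Qed.

Lemma tight_mem (R : realType) (r : R) m s : 0 < r -> r <= 1 / 2 ->
  1 - 2 * r = 2 * rho r * m%:R -> tight r s -> forall a,
  a \in s <-> exists2 i, (i < 6)%N &
    hex_frame i a = (r / 8, Num.sqrt 3 * r / 8) \/
    exists2 j, (1 <= j <= m)%N & a = hex_side i (side_center r j).
Proof.
move=> r0 r2 rm ts a; have /andP[rh1 rh2] := rho_bounds r0; split.
  move=> ains; have [_ _ typ] := ts; have [k ka] := typ a ains.
  exists (k %% 6)%N; first by rewrite ltn_mod.
  rewrite hex_frame_mod; case: ka => [|[p [p1 p2 ka]]]; [by left|right].
  have aE : a = hex_side k p by apply: (@hex_frame_inj _ k); rewrite ka hex_frame_own_side.
  have [_ /(_ p p1 p2)] := tight_side_centers k r0 r2 rm ts (leqnn m).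
  rewrite -aE => /(_ ains) [|[l lm pE]]; last by exists l; rewrite // hex_side_mod -pE.
  (* Center number [m + 1] would be [1 - r + rho], which exceeds [1 - rho]. *)
  by rewrite /side_center -natr1; lra.
move=> [i i6 [ai|[j jm ->]]].
  have [b bs bE] := tight_corner i r0 r2 ts.
  by rewrite (@hex_frame_inj _ i a b)// bE.
by have [+ _] := tight_side_centers i r0 r2 rm ts (leqnn m); apply.
Qed.

(** * The optimal configuration *)

Lemma Rintegral_le_square (R : realType) (f : R -> R) (c h s t : R) :
  continuous f -> s <= t -> (forall x, s <= x <= t -> f x <= (x - c) ^+ 2 + h) ->
  \int[@lebesgue_measure R]_(x in `[s, t]) f x <=
  ((t - c) ^+ 3 - (s - c) ^+ 3) / 3 + h * (t - s).
Proof.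
move=> cf st fle.
have <- : \int[@lebesgue_measure R]_(x in `[s, t])
    (c ^+ 2 + h + (- 2 * c) * x - (-1) * x ^+ 2) =
    ((t - c) ^+ 3 - (s - c) ^+ 3) / 3 + h * (t - s).
  by rewrite Rintegral_quadratic//; field.
apply: le_Rintegral => //.
- exact: continuous_integrable_itv.
- by apply: continuous_integrable_itv; exact: continuous_quadratic.
- move=> x; rewrite /= in_itv/= => /fle /le_trans; apply.
  by rewrite le_eqVlt; apply/orP; left; apply/eqP; ring.
Qed.

(** Membership is enough for an upper bound: on each piece the distance to the nearest point is at
    most that to the assigned one. *)
Definition has_optimal_points (R : realType) (r : R) m (s : seq (plane R)) : Prop :=
  (forall i, exists2 a, a \in s & hex_frame i a = (r / 8, Num.sqrt 3 * r / 8)) /\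
  (forall i j, (1 <= j <= m)%N -> hex_side i (side_center r j) \in s).

Lemma side_mid_le (R : realType) (r : R) (m : nat) (a0 : plane R) s i j :
  0 < r -> has_optimal_points r m (a0 :: s) -> (j <= m)%N ->
  \int[@lebesgue_measure R]_(t in `[r, r + 2 * rho r * j%:R])
     near_sqdist a0 s (hex_side i t) <= j%:R * (2 / 3 * rho r ^+ 3).
Proof.
move=> r0 [_ centers]; have /andP[rh1 rh2] := rho_bounds r0.
have rh0 : 0 <= rho r by lra.
elim: j => [_|j IH jm].
  by rewrite mulr0 addr0 set_itv1 Rintegral_set1 mul0r.
have cf := @continuous_near_side R i a0 s.
rewrite (Rintegral_itv_cat cf (_ : _ <= r + 2 * rho r * j%:R)); first last.
- by rewrite lerD2l ler_wpM2l ?ler_nat// mulr_ge0.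
- by rewrite lerDl; apply: mulr_ge0 (ler0n _ _); exact: mulr_ge0.
rewrite -[j.+1%:R]natr1 [leRHS]mulrDl mul1r lerD ?IH ?(ltnW jm)//.
have step : r + 2 * rho r * j%:R <= r + 2 * rho r * (j%:R + 1) by lra.
have fle x : r + 2 * rho r * j%:R <= x <= r + 2 * rho r * (j%:R + 1) ->
    near_sqdist a0 s (hex_side i x) <= (x - side_center r j.+1) ^+ 2 + 0.
  move=> _; rewrite addr0.
  apply: le_trans (near_sqdist_le _ (centers i j.+1 _)) _ => //.
  by rewrite sqdist_side hex_frame_own_side /= expr0n addr0.
apply: (le_trans (Rintegral_le_square cf step fle)).
by rewrite /side_center -natr1 le_eqVlt; apply/orP; left; apply/eqP; field.
Qed.

(** Both kinds of pieces cost [13 / 48 * r^2] per unit of length: [rho^2 / 3] on the middle pieces,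
    and the same value on the corner pieces. *)
Lemma side_near_le (R : realType) (r : R) (m : nat) (a0 : plane R) s i :
  0 < r -> r <= 1 / 2 -> 1 - 2 * r = 2 * rho r * m%:R ->
  has_optimal_points r m (a0 :: s) ->
  \int[@lebesgue_measure R]_(t in `[0, 1]) near_sqdist a0 s (hex_side i t) <=
  13 / 48 * r ^+ 2.
Proof.
move=> r0 r2 rm opt; have [corners _] := opt.
have cf := @continuous_near_side R i a0 s.
rewrite (Rintegral_itv_cat cf (ltW r0)); last by lra.
rewrite (Rintegral_itv_cat cf (_ : r <= 1 - r)); [|by lra|by lra].
have r1 : 1 - r <= 1 by lra.
have left_part : \int[@lebesgue_measure R]_(t in `[0, r])
    near_sqdist a0 s (hex_side i t) <= 13 / 48 * r ^+ 3.
  have [a ains aE] := corners i.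
  have fle x : 0 <= x <= r -> near_sqdist a0 s (hex_side i x) <= (x - r / 8) ^+ 2 + 3 * (r / 8) ^+ 2.
    move=> _; apply: le_trans (near_sqdist_le _ ains) _.
    have -> : 3 * (r / 8) ^+ 2 = (Num.sqrt 3 * r / 8) ^+ 2.
      by rewrite !exprMn sqrt3_sqr; field.
    by rewrite sqdist_side aE.
  apply: (le_trans (Rintegral_le_square cf (ltW r0) fle)).
  by rewrite le_eqVlt; apply/orP; left; apply/eqP; field.
have right_part : \int[@lebesgue_measure R]_(t in `[1 - r, 1])
    near_sqdist a0 s (hex_side i t) <= 13 / 48 * r ^+ 3.
  have [a ains aE] := corners (i + 1).
  have fle x : 1 - r <= x <= 1 ->
      near_sqdist a0 s (hex_side i x) <= (x - (1 - r / 8)) ^+ 2 + 3 * (r / 8) ^+ 2.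
    move=> _; apply: le_trans (near_sqdist_le _ ains) _.
    have := sqdist_prev_side (i + 1) (1 - x) a.
    rewrite -addnA -hex_side_mod modnDr hex_side_mod subKr aE => -> /=.
    have z2 := sqrt3_sqr R; move: z2; set z := Num.sqrt 3 => z2.
    have -> : (z * (1 - x) / 2 - z * r / 8) ^+ 2 = z ^+ 2 * ((1 - x) / 2 - r / 8) ^+ 2.
      by field.
    by rewrite z2 le_eqVlt; apply/orP; left; apply/eqP; field.
  apply: (le_trans (Rintegral_le_square cf r1 fle)).
  by rewrite le_eqVlt; apply/orP; left; apply/eqP; field.
have mid_part := side_mid_le i r0 opt (leqnn m).
have mE : r + 2 * rho r * m%:R = 1 - r by lra.
rewrite mE in mid_part.
have rho3 : m%:R * (2 / 3 * rho r ^+ 3) = 13 / 48 * r ^+ 2 * (1 - 2 * r).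
  by rewrite rm exprS rho_sqr; field.
rewrite rho3 in mid_part.
lra.
Qed.

Lemma energy_le (R : realType) (r : R) (m : nat) (a0 : plane R) s :
  0 < r -> r <= 1 / 2 -> 1 - 2 * r = 2 * rho r * m%:R ->
  has_optimal_points r m (a0 :: s) ->
  energy a0 s <= 13 / 8 * r ^+ 2.
Proof.
move=> r0 r2 rm opt.
have -> : 13 / 8 * r ^+ 2 = \sum_(i < 6) (13 / 48 * r ^+ 2).
  by rewrite sumr_const card_ord -mulr_natl; field.
by apply: ler_sum => i _; exact: (@side_near_le _ _ m).
Qed.

Lemma energy_tight (R : realType) (r : R) (m : nat) (a0 : plane R) s :
  0 < r -> r <= 1 / 2 -> r * (Num.sqrt 13 * m%:R / 2 + 2) = 1 ->
  (size (a0 :: s) <= 6 * m.+1)%N -> energy a0 s = 13 / 8 * r ^+ 2 ->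
  tight r (a0 :: s).
Proof.
move=> r0 r2 rm sz E; have [_ /(_ E)[ex0 gmax]] := energy_bound r0 r2 rm sz.
split.
- by move=> i t t01; have [] := excess_eq0 (ex0 i t t01).
- by move=> i t t01; have [] := excess_eq0 (ex0 i t t01).
- by move=> a ains; have [_ /(_ (gmax a ains))] := total_gain_bound a r0 r2.
Qed.

(** * Identification with the explicit set *)

Lemma side_affine_image (R : realType) (T : plane R -> plane R) i :
  affine_transformation T ->
  T @` segment (hexv R 0) (hexv R 1) = segment (hexv R i) (hexv R i.+1) ->
  (forall t, T (t, 0) = hex_side i t) \/ (forall t, T (t, 0) = hex_side i (1 - t)).
Proof.
move=> [a [b [c [d [e [f [_ TE]]]]]]] Tseg.
have seg0 t : seg_param (hexv R 0) (hexv R 1) t = (t, 0).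
  by have := @hex_side_coord R 0 t isT.
have side_inj (x y : R) : hex_side i x = hex_side i y -> x = y.
  by move/(congr1 (@hex_frame R i)); rewrite !hex_frame_own_side => -[].
have img t : 0 <= t <= 1 -> exists2 x, 0 <= x <= 1 & T (t, 0) = hex_side i x.
  move=> t01; have : (T @` segment (hexv R 0) (hexv R 1)) (T (t, 0)).
    by exists (t, 0) => //; exists t; rewrite ?seg0//= in_itv.
  by rewrite Tseg => -[x /= x01 <-]; exists x => //; move: x01; rewrite in_itv.
have pre x : 0 <= x <= 1 -> exists2 t, 0 <= t <= 1 & T (t, 0) = hex_side i x.
  move=> x01; have : segment (hexv R i) (hexv R i.+1) (hex_side i x).
    by exists x; rewrite //= in_itv.
  rewrite -Tseg => -[_ [t /= t01 <-]]; rewrite seg0 => E.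
  by exists t => //; move: t01; rewrite in_itv.
have [x /andP[x0 x1] xE] := img 0 (introT andP (conj (lexx 0) ler01)).
have [y /andP[y0 y1] yE] := img 1 (introT andP (conj ler01 (lexx 1))).
have Tt t : T (t, 0) = hex_side i ((1 - t) * x + t * y).
  have -> : T (t, 0) = ((1 - t) * (T (0, 0)).1 + t * (T (1, 0)).1,
                        (1 - t) * (T (0, 0)).2 + t * (T (1, 0)).2).
    by rewrite !TE /=; congr pair; ring.
  by rewrite xE yE /hex_side /seg_param /=; congr pair; ring.
(* Both 0 and 1 are convex combinations of [x] and [y], which lie in [[0, 1]]; each nonnegative term
   [p1] to [p4] therefore vanishes, and [x], [y] are 0 and 1 in some order. *)
have [t0 /andP[t00 t01]] := pre 0 (introT andP (conj (lexx 0) ler01)).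
rewrite Tt => /side_inj E0.
have [t1 /andP[t10 t11]] := pre 1 (introT andP (conj ler01 (lexx 1))).
rewrite Tt => /side_inj E1.
have p1 : 0 <= (1 - t0) * x by rewrite mulr_ge0 ?subr_ge0.
have p2 : 0 <= t0 * y by rewrite mulr_ge0.
have p3 : 0 <= (1 - t1) * (1 - x) by rewrite mulr_ge0 ?subr_ge0.
have p4 : 0 <= t1 * (1 - y) by rewrite mulr_ge0 ?subr_ge0.
have /eqP : (1 - t0) * x = 0 by lra.
have /eqP : t0 * y = 0 by lra.
have /eqP : (1 - t1) * (1 - x) = 0 by lra.
have /eqP : t1 * (1 - y) = 0 by lra.
rewrite !mulf_eq0 !subr_eq0 => /orP h1 /orP h2 /orP h3 /orP h4.
have [|] : (x = 0 /\ y = 1) \/ (x = 1 /\ y = 0).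
  by case: h1 => /eqP h1; case: h2 => /eqP h2; case: h3 => /eqP h3;
     case: h4 => /eqP h4; (try by left; split; lra); (try by right; split; lra);
     exfalso; lra.
- by move=> [xv yv]; left => t; rewrite Tt xv yv; congr hex_side; ring.
- by move=> [xv yv]; right => t; rewrite Tt xv yv; congr hex_side; ring.
Qed.

Definition corner_point (R : realType) (r : R) (i : nat) : plane R :=
  let z := Num.sqrt 3 in
  nth (0, 0) [:: (r / 8, z * r / 8); (1 - r / 8, z * r / 8); ((6 - r) / 4, z / 2);
    (1 - r / 8, - (z / 8) * (r - 8)); (r / 8, - (z / 8) * (r - 8));
    ((r - 2) / 4, z / 2)] i.

Lemma hex_frame_corner_point (R : realType) (r : R) i : (i < 6)%N ->
  hex_frame i (corner_point r i) = (r / 8, Num.sqrt 3 * r / 8).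
Proof.
have z2 := sqrt3_sqr R; have : Num.sqrt 3 ^+ 2 * r = 3 * r by rewrite z2.
move: z2; case: i => [|[|[|[|[|[|//]]]]]] + + _;
  rewrite /hex_frame /corner_point /hexv /=;
  by set z := Num.sqrt 3 => z2 z2r; congr pair; lra.
Qed.

Definition optimal_points (R : realType) (r : R) (m : nat) : seq (plane R) :=
  [seq corner_point r i | i <- iota 0 6] ++
  [seq hex_side i (side_center r j) | i <- iota 0 6, j <- iota 1 m].

Lemma size_optimal_points (R : realType) (r : R) m :
  size (optimal_points r m) = (6 * m.+1)%N.
Proof. by rewrite size_cat size_map size_allpairs !size_iota mulnS. Qed.

Lemma mem_optimal_points (R : realType) (r : R) m (a : plane R) :
  a \in optimal_points r m <-> exists2 i, (i < 6)%N &
    hex_frame i a = (r / 8, Num.sqrt 3 * r / 8) \/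
    exists2 j, (1 <= j <= m)%N & a = hex_side i (side_center r j).
Proof.
rewrite /optimal_points mem_cat; split.
  case/orP => [/mapP[i]|/allpairsP[[i j] [i6 jm ->]]].
    by rewrite mem_iota => i6 ->; exists i => //; left; rewrite hex_frame_corner_point.
  move: i6 jm; rewrite !mem_iota add1n ltnS => i6 jm.
  by exists i => //; right; exists j.
move=> [i i6 [ai|[j jm ->]]]; apply/orP; [left|right].
  apply/mapP; exists i; first by rewrite mem_iota.
  by apply: (@hex_frame_inj _ i); rewrite hex_frame_corner_point.
have iin : i \in iota 0 6 by rewrite mem_iota.
have jin : j \in iota 1 m by rewrite mem_iota add1n ltnS.
by apply/allpairsP; exists (i, j).
Qed.

Lemma optimal_means (R : realType) (r : R) (m : nat) :
  0 < r -> r <= 1 / 2 -> r * (Num.sqrt 13 * m%:R / 2 + 2) = 1 ->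
  (forall alpha, optimal_set (hexagon_uniform R) (6 * m.+1) alpha <->
     alpha = [set` optimal_points r m]) /\
  quantization_error (hexagon_uniform R) (6 * m.+1) = (13 / 48 * r ^+ 2)%:E.
Proof.
move=> r0 r2 rm.
have rm' : 1 - 2 * r = 2 * rho r * m%:R by rewrite /rho; lra.
set s := optimal_points r m.
have [a0 [s0 sE]] : exists a0 s0, s = a0 :: s0.
  by rewrite /s /optimal_points /=; eexists; eexists.
have opt : has_optimal_points r m (a0 :: s0).
  rewrite -sE; split => [i|i j jm].
    exists (corner_point r (i %% 6)).
      apply/mem_optimal_points; exists (i %% 6)%N; first by rewrite ltn_mod.
      by left; rewrite hex_frame_corner_point// ltn_mod.
    by rewrite -hex_frame_mod hex_frame_corner_point// ltn_mod.
  apply/mem_optimal_points; exists (i %% 6)%N; first by rewrite ltn_mod.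
  by right; exists j; rewrite // hex_side_mod.
have sz : (size (a0 :: s0) <= 6 * m.+1)%N by rewrite -sE size_optimal_points.
have Es : energy a0 s0 = 13 / 8 * r ^+ 2.
  apply/eqP; rewrite eq_le (energy_le r0 r2 rm' opt) /=.
  by have [] := energy_bound r0 r2 rm sz.
have V : distortion (hexagon_uniform R) [set` s] = (13 / 48 * r ^+ 2)%:E.
  by rewrite sE distortion_energy Es; congr EFin; field.
have lb alpha : alpha #<= `I_(6 * m.+1) ->
    ((13 / 48 * r ^+ 2)%:E <= distortion (hexagon_uniform R) alpha)%E.
  move=> /card_le_seq[[|b t] [-> szt]].
    by rewrite (_ : [set` [::]] = set0) ?distortion_set0 ?leey// -subset0.
  have [E _] := energy_bound r0 r2 rm szt.
  by rewrite distortion_energy lee_fin ler_pdivlMr//; lra.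
have cs : [set` s] #<= `I_(6 * m.+1) by rewrite sE; exact: seq_card_le.
have QE : quantization_error (hexagon_uniform R) (6 * m.+1) = (13 / 48 * r ^+ 2)%:E.
  apply/eqP; rewrite eq_le; apply/andP; split.
    by rewrite -V; apply: ereal_inf_lbound; exists [set` s].
  by apply: le_ereal_inf_tmp => _ [alpha /= ca <-]; exact: lb.
split=> // alpha; split; last by move=> ->; split; rewrite // QE V.
move=> [/card_le_seq[[|b t] [-> szt]]]; rewrite QE.
  by rewrite (_ : [set` [::]] = set0) ?distortion_set0// -subset0.
rewrite distortion_energy => -[] E6.
have E : energy b t = 13 / 8 * r ^+ 2 by lra.
(* Uniqueness: an optimal list is tight, and tightness determines its members. *)
have tt := energy_tight r0 r2 rm szt E.
have mm := tight_mem r0 r2 rm' tt.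
by apply/seteqP; split => x /=; rewrite -/s => h;
  [apply/mem_optimal_points; apply/mm | apply/mm; apply/mem_optimal_points].
Qed.

(** The maps [T i] may reverse a side; by this symmetry the image of [gamma] does not depend on the
    orientation. *)
Lemma side_center_sym (R : realType) (r : R) m j : 1 - 2 * r = 2 * rho r * m%:R ->
  (1 <= j <= m)%N -> side_center r (m.+1 - j) = 1 - side_center r j.
Proof.
move=> rm /andP[j1 jm]; rewrite /side_center natrB ?(leq_trans jm)// -natr1.
lra.
Qed.

Theorem theorem3p8 (R : realType) (n k : nat)
    (k_gt0 : (0 < k)%N) (n6k : n = (6 * k)%N)
    (T : nat -> plane R -> plane R)
    (T_affine : forall i : nat, (1 <= i <= 5)%N -> affine_transformation (T i))
    (T_side : forall i : nat, (1 <= i <= 5)%N ->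
      T i @` segment (hexv R 0) (hexv R 1) =
      segment (hexv R i) (hexv R i.+1)) :
  let m : R := k%:R - 1 in
  let s3 : R := Num.sqrt 3 in
  let s13 : R := Num.sqrt 13 in
  let r : R := 2 * (s13 * m - 4) / (13 * m ^+ 2 - 16) in
  let gamma : set (plane R) :=
    if (2 <= k)%N then
      [set (r + (2 * j%:R - 1) / (2 * m) * (1 - 2 * r), 0)
        | j in [set j : nat | (1 <= j <= k - 1)%N]]
    else set0 in
  let alpha_n : set (plane R) :=
    [set (r / 8, s3 * r / 8)] `|`
    [set (1 - r / 8, s3 * r / 8)] `|`
    [set ((6 - r) / 4, s3 / 2)] `|`
    [set (1 - r / 8, - (s3 / 8) * (r - 8))] `|`
    [set (r / 8, - (s3 / 8) * (r - 8))] `|`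
    [set ((r - 2) / 4, s3 / 2)] `|`
    gamma `|`
    \bigcup_(i in [set i : nat | (1 <= i <= 5)%N]) (T i @` gamma) in
  (forall alpha : set (plane R),
     optimal_set (hexagon_uniform R) n alpha <-> alpha = alpha_n) /\
  quantization_error (hexagon_uniform R) n =
    (13 * (13 * m ^+ 2 - 8 * s13 * m + 16) /
       (12 * (16 - 13 * m ^+ 2) ^+ 2))%:E.
Proof.
case: k k_gt0 n6k => [//|m] _ -> mm s3 s13 r gamma alpha_n.
have mE : mm = m%:R by rewrite /mm -natr1 addrK.
have w2 : s13 ^+ 2 = 13 by exact: sqrt13_sqr.
have w0 : 0 < s13 by exact: sqrt13_gt0.
have m0 : 0 <= mm by rewrite mE.
have d0 : s13 * mm + 4 != 0 by rewrite gt_eqF// ltr_wpDl ?mulr_ge0// ltW.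
(* The factor common to the numerator and the denominator of [r]; it is nonzero because
   [13 x^2 = 16] has no natural solution. Cancelling it leaves [r = 2 / (sqrt 13 (k - 1) + 4)]. *)
have n0 : s13 * mm - 4 != 0.
  apply/negP => /eqP h; have : 13 * mm ^+ 2 = 16.
    by rewrite -w2 -exprMn (_ : s13 * mm = 4); [ring|lra].
  have [|m1] := leqP 2 m.
    by rewrite -(ler_nat R) -mE => ?; nra.
  have : mm = 0 \/ mm = 1 by rewrite mE; case: (m) m1 => [|[|//]] _; [left|right].
  by case=> ->; lra.
have denE : 13 * mm ^+ 2 - 16 = (s13 * mm - 4) * (s13 * mm + 4).
  by rewrite -w2; ring.
have rE : r = 2 / (s13 * mm + 4).
  by rewrite /r denE; field; rewrite d0 n0.
have r0 : 0 < r by rewrite rE divr_gt0// ltr_wpDl ?mulr_ge0// ltW.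
have r2 : r <= 1 / 2.
  rewrite rE ler_pdivrMr; last by rewrite ltr_wpDl ?mulr_ge0// ltW.
  have : 0 <= s13 * mm by rewrite mulr_ge0// ltW.
  lra.
have rm : r * (s13 * m%:R / 2 + 2) = 1 by rewrite -mE rE; field.
have rm' : 1 - 2 * r = 2 * rho r * m%:R by rewrite /rho -/s13; lra.
have gammaE : gamma = [set (side_center r j, 0) | j in [set j | (1 <= j <= m)%N]].
  rewrite /gamma subn1 /=; case: ifPn => [m1|]; last first.
    by case: (m) => // _; apply/seteqP; split => // x [[|j] //=].
  have mn0 : m%:R != 0 :> R by rewrite pnatr_eq0 -lt0n.
  apply: eq_imagel => j _; congr pair; rewrite /side_center rm' mE.
  by field.
have -> : alpha_n = [set` optimal_points r m].
  have point i : (i < 6)%N -> corner_point r i \in optimal_points r m.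
    move=> i6; apply/mem_optimal_points; exists i => //.
    by left; rewrite hex_frame_corner_point.
  have side i j : (i < 6)%N -> (1 <= j <= m)%N ->
      hex_side i (side_center r j) \in optimal_points r m.
    by move=> i6 jm; apply/mem_optimal_points; exists i => //; right; exists j.
  have sym j : (1 <= j <= m)%N -> (1 <= m.+1 - j <= m)%N by lia.
  have TE i : (1 <= i <= 5)%N -> T i @` gamma =
      [set hex_side i (side_center r j) | j in [set j | (1 <= j <= m)%N]].
    move=> i5; rewrite gammaE image_comp.
    have [h|h] := side_affine_image (T_affine i i5) (T_side i i5).
      by apply: eq_imagel => j _ /=; rewrite h.
    apply/seteqP; split => _ [j /= jm <-]; exists (m.+1 - j)%N; rewrite /= ?sym//.
      by rewrite h side_center_sym.
    by rewrite h side_center_sym// subKr.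
  apply/seteqP; split => a.
    move=> [[[[[[[->|->]|->]|->]|->]|->]|]|[i i5]].
    - exact: (point 0%N).
    - exact: (point 1%N).
    - exact: (point 2%N).
    - exact: (point 3%N).
    - exact: (point 4%N).
    - exact: (point 5%N).
    - rewrite gammaE => -[j /= jm <-]; have := side 0%N j isT jm.
      by rewrite hex_side_coord.
    - have /andP[_ i6] : (1 <= i <= 5)%N := i5.
      by rewrite TE// => -[j /= jm <-]; exact: side.
  move=> /mem_optimal_points[i i6 [ai|[j jm ->]]]; last first.
    case: i i6 => [|i] i6; last by right; exists i.+1 => //; rewrite TE//; exists j.
    by left; right; rewrite gammaE; exists j => //; rewrite hex_side_coord.
  left; left; have -> : a = corner_point r i.
    by apply: (@hex_frame_inj _ i); rewrite ai hex_frame_corner_point.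
  by case: i i6 {ai} => [|[|[|[|[|[|//]]]]]] _; rewrite /corner_point /=;
    do ?[by right|left].
have [optE VE] := optimal_means r0 r2 rm; split => //.
rewrite VE; congr EFin.
have -> : 13 * mm ^+ 2 - 8 * s13 * mm + 16 = (s13 * mm - 4) ^+ 2.
  by rewrite -w2; ring.
have -> : 16 - 13 * mm ^+ 2 = - ((s13 * mm - 4) * (s13 * mm + 4)) by rewrite -denE; ring.
by rewrite rE; field; rewrite d0 n0.
Qed.
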